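(* Let $\beta\in(0,1)$, $\sigma>0$ and $s\in\{1,\ldots,d\}$ be fixed numbers, and let $d=d_\varepsilon\to\infty$ and $\varepsilon^2(\log d)^{1+2\sigma}=o(1)$ as $\varepsilon\to0$. Assume that the family of collections $r_\varepsilon=\{r_{\varepsilon,k},\,1\le k\le s\}$, $r_{\varepsilon,k}>0$, is such that (for arbitrary $u_k\in\mathcal U_{k,d}$, $1\le k\le s$) $$\limsup_{\varepsilon\to0}\min_{1\le k\le s}\frac{a_{\varepsilon,u_k}(r_{\varepsilon,k})}{\sqrt{2\log\binom{d}{k}}}<\sqrt\beta.$$ Then $$\liminf_{\varepsilon\to0}\ \inf_{\tilde{\boldsymbol\eta}}\ \sup_{\boldsymbol\eta\in\mathcal H^s_{\beta,d}}\ \sup_{\boldsymbol\theta\in\Theta^\sigma_{s,d}(r_\varepsilon)}\mathrm E_{\boldsymbol\theta,\boldsymbol\eta}\left\{\sum_{k=1}^s\binom dk^{\beta-1}|\tilde{\boldsymbol\eta}_k-\boldsymbol\eta_k|\right\}>0,$$ where the infimum is over all selectors $\tilde{\boldsymbol\eta}=(\tilde{\boldsymbol\eta}_1,\ldots,\tilde{\boldsymbol\eta}_s)$ of $\boldsymbol\eta$, i.e. all estimators based on the observed data with $\tilde{\boldsymbol\eta}_k\in\{0,1\}^{\binom dk}$, $1\le k\le s$.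
   Context: Index sets. For $1\le k\le d$, $\mathcal U_{k,d}$ is the set of all subsets $u_k\subseteq\{1,\ldots,d\}$ with $k$ elements. For $u_k\in\mathcal U_{k,d}$, $\mathring{\mathbb Z}_{u_k}=\{\boldsymbol\ell=(l_1,\ldots,l_d)\in\mathbb Z^d:\ l_j=0 \text{ for } j\notin u_k,\ l_j\ne0\text{ for }j\in u_k\}$. Sparsity classes. $H^k_{\beta,d}=H^k_{\beta,d}(\varepsilon)$ is the set of $\boldsymbol\eta_k=(\eta_{u_k})_{u_k\in\mathcal U_{k,d}}$ with $\eta_{u_k}\in\{0,1\}$ and $\sum_{u_k\in\mathcal U_{k,d}}\eta_{u_k}=\binom dk^{1-\beta}(1+o(1))$ as $\varepsilon\to0$. The $o(1)$ is uniform: membership means $|\binom dk^{\beta-1}\sum\eta_{u_k}-1|\le\delta_\varepsilon$ for a fixed family $\delta_\varepsilon\to0$, large enough that all vectors with exactly $[\binom dk^{1-\beta}]$ ones (integer part) are included; one may think of the number of ones as being this integer part. $\mathcal H^s_{\beta,d}=\{\boldsymbol\eta=(\boldsymbol\eta_1,\ldots,\boldsymbol\eta_s):\boldsymbol\eta_k\in H^k_{\beta,d},\,1\le k\le s\}$. Ellipsoids. $c_{\boldsymbol\ell}^2=\big(\sum_{j=1}^d(2\pi l_j)^2\big)^\sigma$. For $r>0$, $\mathring\Theta_{\mathbf c_{u_k}}(r)$ is the set of real families $\boldsymbol\theta_{u_k}=(\theta_{\boldsymbol\ell}(u_k))_{\boldsymbol\ell\in\mathring{\mathbb Z}_{u_k}}$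 with $\sum_{\boldsymbol\ell}\theta_{\boldsymbol\ell}^2(u_k)c_{\boldsymbol\ell}^2\le1$ and $\sum_{\boldsymbol\ell}\theta_{\boldsymbol\ell}^2(u_k)\ge r^2$. $\mathring\Theta^\sigma_{k,d}(r)$ is the set of $\boldsymbol\theta_k=(\boldsymbol\theta_{u_k})_{u_k\in\mathcal U_{k,d}}$ with $\boldsymbol\theta_{u_k}\in\mathring\Theta_{\mathbf c_{u_k}}(r)$ for every $u_k$. $\Theta^\sigma_{s,d}(r_\varepsilon)=\{\boldsymbol\theta=(\boldsymbol\theta_1,\ldots,\boldsymbol\theta_s):\boldsymbol\theta_k\in\mathring\Theta^\sigma_{k,d}(r_{\varepsilon,k}),\,1\le k\le s\}$. Standing convention: $r_{\varepsilon,k}\in(0,(2\pi)^{-\sigma}k^{-\sigma/2})$ (for larger radii the set is empty). Model. For noise level $\varepsilon>0$ one observes $X_{\boldsymbol\ell}=\eta_{u_k}\theta_{\boldsymbol\ell}(u_k)+\varepsilon\xi_{\boldsymbol\ell}$, $\boldsymbol\ell\in\mathring{\mathbb Z}_{u_k}$, $u_k\in\mathcal U_{k,d}$, $1\le k\le s$, where all $\xi_{\boldsymbol\ell}$ are i.i.d. $N(0,1)$. $\mathrm E_{\boldsymbol\theta,\boldsymbol\eta}$ is the expectation under this model. For $\{0,1\}$-valued vectors indexed by $\mathcal U_{k,d}$, $|\boldsymbol\eta_k-\boldsymbol\eta_k'|=\sum_{u_k\in\mathcal U_{k,d}}|\eta_{u_k}-\eta'_{u_k}|$ (Hamming distance).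 Detection function. $a_{\varepsilon,u_k}(r)\ge0$ is given by $$a^2_{\varepsilon,u_k}(r)=\frac1{2\varepsilon^4}\inf_{\boldsymbol\theta_{u_k}\in\mathring\Theta_{\mathbf c_{u_k}}(r)}\sum_{\boldsymbol\ell\in\mathring{\mathbb Z}_{u_k}}\theta_{\boldsymbol\ell}(u_k)^4;$$ it depends on $u_k$ only through $k$. *)

(* Defs.v *)
From HB Require Import structures.
From mathcomp Require Export all_boot all_order all_algebra.
From mathcomp Require Export all_classical all_reals all_analysis.

Export Order.TTheory GRing.Theory Num.Theory.
Export numFieldNormedType.Exports.

#[export] Set Implicit Arguments.
#[export] Unset Strict Implicit.
#[export] Unset Printing Implicit Defensive.

Open Scope classical_set_scope.
Open Scope ring_scope.

Definition Usets (d k : nat) : {set {set 'I_d}} := [set u : {set 'I_d} | #|u| == k]%SET.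

Definition freq (d : nat) : choiceType := {ffun 'I_d -> int}.

Definition Zring (d : nat) (u : {set 'I_d}) : set (freq d) :=
  [set l | forall j : 'I_d, (j \notin u -> l j = 0) /\ (j \in u -> l j != 0)].

Definition supp (d : nat) (l : freq d) : {set 'I_d} := [set j : 'I_d | l j != 0]%SET.

(* The sets [Zring u] partition Z^d, and [supp l] is the only [u] such that
   [l] belongs to [Zring u]. *)
Lemma Zring_supp (d : nat) (u : {set 'I_d}) (l : freq d) :
  Zring u l <-> supp l = u.
Proof.
split=> [H|<- j]; last by rewrite inE negbK; split=> [/eqP|].
apply/setP => j; rewrite inE; have [H1 H2] := H j.
by case: (boolP (j \in u)) => [/H2|/H1 ->]; rewrite ?eqxx.
Qed.

(* A collection (eta_1, ..., eta_s) of {0,1}-valued vectors eta_k indexed by the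
   k-subsets of {1, ..., d} is encoded as one function on all subsets: eta_k is
   its restriction to [Usets d k], and the values at sets whose cardinality
   lies outside 1, ..., s are never used. *)
Definition bvecs (d : nat) : Type := {set 'I_d} -> bool.

(* [H^k_{beta,d}]; [delta] is the value, at the current noise level, of the
   family that makes the o(1) term precise. *)
Definition Hclass (R : realType) (beta delta : R) (d k : nat) : set (bvecs d) :=
  [set eta |
    `| 'C(d, k)%:R `^ (beta - 1) * (\sum_(u in Usets d k) eta u)%N%:R - 1 |
      <= delta].

Definition Hclasses (R : realType) (beta : R) (delta : nat -> R) (d s : nat) :
    set (bvecs d) :=
  [set eta | forall k, (1 <= k <= s)%N -> Hclass beta (delta k) k eta].

(* [c_l^2] *)
Definition csq (R : realType) (sigma : R) (d : nat) (l : freq d) : R :=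
  (\sum_(j < d) (2 * pi * (l j)%:~R) ^+ 2) `^ sigma.

(* A family indexed by [Zring u] is encoded as a function on Z^d whose values
   outside [Zring u] are never used. *)
Definition Theta_ring (R : realType) (sigma r : R) (d : nat) (u : {set 'I_d}) :
    set (freq d -> R) :=
  [set theta |
    (\esum_(l in Zring u) (theta l ^+ 2 * csq sigma l)%:E <= 1)%E /\
    ((r ^+ 2)%:E <= \esum_(l in Zring u) (theta l ^+ 2)%:E)%E].

Definition Theta (R : realType) (sigma : R) (r : nat -> R) (d s : nat) :
    set ({set 'I_d} -> freq d -> R) :=
  [set theta | forall k (u : {set 'I_d}), (1 <= k <= s)%N -> u \in Usets d k ->
    Theta_ring sigma (r k) u (theta u)].

(* [a_{eps,u}(r)]: the infimum is a nonnegative real number as soon as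
   [Theta_ring sigma r u] is nonempty, which is what makes [fine] harmless. *)
Definition detect (R : realType) (sigma eps : R) (d : nat) (u : {set 'I_d})
    (r : R) : R :=
  Num.sqrt ((2 * eps ^+ 4)^-1 *
    fine (ereal_inf [set (\esum_(l in Zring u) (theta l ^+ 4)%:E)%E
                    | theta in Theta_ring sigma r u])).

(* The frequencies that are observed: by [Zring_supp], the union of the sets
   [Zring u] over the sets [u] with k elements, 1 <= k <= s. *)
Definition obs_index (d s : nat) : choiceType :=
  {l : freq d | (1 <= #|supp l| <= s)%N}.

Definition data (R : realType) (d s : nat) : Type := obs_index d s -> R.

Definition cylinders (R : realType) (d s : nat) : set (set (data R d s)) :=
  [set A | exists i (B : set R), measurable B /\ A = [set x | B (x i)]].

(* Nonrandomized estimators of the collection eta that are measurable for the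
   product sigma-algebra on the space of data. *)
Definition selector (R : realType) (d s : nat) : set (data R d s -> bvecs d) :=
  [set etat | forall u : {set 'I_d}, (1 <= #|u| <= s)%N ->
    <<s @cylinders R d s >> [set x | etat x u]].

Definition mutually_independent (R : realType) (disp : measure_display)
    (Omega : measurableType disp) (P : probability Omega R) (I : choiceType)
    (xi : I -> {RV P >-> R}) : Prop :=
  forall (J : seq I) (B : I -> set R), uniq J ->
    (forall i, measurable (B i)) ->
    P (\bigcap_(i in [set` J]) xi i @^-1` B i) =
    (\prod_(i <- J) P (xi i @^-1` B i))%E.

Definition iid_std_normal (R : realType) (disp : measure_display)
    (Omega : measurableType disp) (P : probability Omega R) (I : choiceType)
    (xi : I -> {RV P >-> R}) : Prop :=
  mutually_independent xi /\
  forall i (B : set R), measurable B ->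
    distribution P (xi i) B = normal_prob (0 : R) 1 B.

Definition observation (R : realType) (eps : R) (d s : nat) (eta : bvecs d)
    (theta : {set 'I_d} -> freq d -> R) (noise : data R d s) : data R d s :=
  fun i => (eta (supp (val i)))%:R * theta (supp (val i)) (val i)
           + eps * noise i.

Definition hamming (R : realType) (d k : nat) (eta eta' : bvecs d) : R :=
  \sum_(u in Usets d k) `| (eta u)%:R - (eta' u)%:R |.

Definition loss (R : realType) (beta : R) (d s : nat) (etat eta : bvecs d) : R :=
  \sum_(1 <= k < s.+1) 'C(d, k)%:R `^ (beta - 1) * hamming R k etat eta.

Definition risk (R : realType) (beta eps : R) (d s : nat)
    (disp : measure_display) (Omega : measurableType disp)
    (P : probability Omega R) (xi : obs_index d s -> {RV P >-> R})
    (etat : data R d s -> bvecs d) (eta : bvecs d)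
    (theta : {set 'I_d} -> freq d -> R) : \bar R :=
  'E_P[fun w =>
    loss beta s (etat (observation eps eta theta (fun i => xi i w))) eta]%E.

Definition minimax_risk (R : realType) (beta sigma eps : R) (delta r : nat -> R)
    (d s : nat) (disp : measure_display) (Omega : measurableType disp)
    (P : probability Omega R) (xi : obs_index d s -> {RV P >-> R}) : \bar R :=
  ereal_inf [set
    ereal_sup [set
      ereal_sup [set risk beta eps xi etat eta theta
                | theta in @Theta R sigma r d s]
      | eta in @Hclasses R beta delta d s]
    | etat in @selector R d s].

(* Main.v *)
From HB Require Import structures.
Require Import Defs.
From mathcomp Require Import measurable_realfun ring lra.
Import HBNNSimple.

(* Fix a cardinality k whose detection ratio is below sqrt(beta), let
   N = C(d, k), and split the k-subsets into about N^(1 - beta) blocks of about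
   N^beta sets.  The prior puts one active set, the needle, uniformly at random
   in every block, and multiplies a nearly extremal theta, cut down to finitely
   many frequencies, by independent random signs.  Given the rest of the
   configuration, the sign-averaged likelihood ratio Lambda of a needle has
   entropy E[Lambda ln Lambda] <= b1 ln N with b1 < beta.  Hence Lambda is
   truncated at T = N^b2, b1 < b2 < beta, at a cost of at most b1/b2 + o(1), and
   since the events "the needle of this block is recognised at v" are disjoint
   in v, a needle is found with probability at most
   N^(b2 - beta) + b1/b2 + o(1).  A fixed fraction of the blocks is thus
   misclassified on average, and each contributes at least 1 to the Hamming
   loss. *)

(** With a known [theta] the entropy of a needle would be half the sum of [(theta / eps)^2]. Random
    signs cancel this quadratic term and leave at most a quarter of the sum of [(theta / eps)^4],
    which for an extremal [theta] is half the squared detection function: an entropy below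
    [beta ln N] then matches a detection ratio below [sqrt beta] exactly. Only the mean of
    [Lambda ln Lambda] is controlled, so truncation costs a fixed fraction; a success probability
    bounded away from 1 is enough for a positive lower limit. One needle per block, rather than
    independent Bernoulli entries, makes the number of active sets exactly the integer part of
    [N^(1 - beta)], so every configuration lies in the sparsity class. The prior enters only as a
    finite average over configurations, from which one bad configuration is extracted for each
    selector. Finitely many frequencies turn the likelihood ratio into a finite product, but a
    selector sees the whole infinite family of observations, so the change of measure has to hold
    for measurable functions of all the data. *)

(** * Integration against densities and the one-dimensional Gaussian shift *)

Section density.
Local Open Scope ereal_scope.
Context disp (T : measurableType disp) (R : realType).
Variables (mu nu : {measure set T -> \bar R}) (g : T -> R).
Hypotheses (g0 : forall x, (0 <= g x)%R) (mg : measurable_fun setT g).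
Hypothesis nuE : forall A, measurable A -> nu A = \int[mu]_(x in A) (g x)%:E.

(** Both sides are continuous along the increasing simple approximations [h], and on a level set of
    [h n] the identity is [nuE]. The measure [nu] is known only through its values, so the lemma
    serves the normal law, restricted measures and push-forwards alike. *)
Lemma ge0_integral_density (f : T -> \bar R) :
  measurable_fun setT f -> (forall x, 0 <= f x) ->
  \int[nu]_x f x = \int[mu]_x (f x * (g x)%:E).
Proof.
move=> mf f0; pose h := nnsfun_approx measurableT mf.
have mgE : measurable_fun setT (EFin \o g) by exact/measurable_EFinP.
have hf x : (h n x)%:E @[n --> \oo] --> f x by exact: cvg_nnsfun_approx.
have ndh : forall x, {homo (fun n => (h n x)%:E) : a b / (a <= b)%N >-> a <= b}.
  by move=> x a b ab; rewrite lee_fin; exact/lefP/nd_nnsfun_approx.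
have mh n : measurable_fun setT (EFin \o h n).
  by apply/measurable_EFinP; exact/measurable_funP.
have -> : \int[nu]_x f x = limn (fun n => \int[nu]_x (h n x)%:E).
  rewrite -monotone_convergence//.
  - by apply: eq_integral => x _; apply/esym/cvg_lim => //; exact: hf.
  - by move=> n x _; rewrite lee_fin.
have -> : \int[mu]_x (f x * (g x)%:E) =
    limn (fun n => \int[mu]_x ((h n x)%:E * (g x)%:E)).
  rewrite -monotone_convergence//.
  - apply: eq_integral => x _; apply/esym/cvg_lim => //.
    by apply: cvgeZr => //; exact: hf.
  - by move=> n; apply: emeasurable_funM => //; exact: mh.
  - by move=> n x _; rewrite mule_ge0// lee_fin.
  - by move=> x _ a b ab; rewrite lee_wpmul2r ?lee_fin//; exact: ndh.
suff suf n : \int[nu]_x (h n x)%:E = \int[mu]_x ((h n x)%:E * (g x)%:E).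
  by under eq_fun do rewrite suf.
have mi (r : R) : measurable (h n @^-1` [set r]) by exact: measurable_sfunP.
transitivity (\int[nu]_x
   (\sum_(y \in range (h n)) (y * \1_(h n @^-1` [set y]) x)%:E)).
  by apply: eq_integral => t tE; rewrite /= fimfunE -fsumEFin.
rewrite ge0_integral_fsum//; last 2 first.
- by move=> r; apply/measurable_EFinP; exact: measurable_funM.
- by move=> m y Ey; exact: nnfun_muleindic_ge0.
transitivity (\int[mu]_x (\sum_(y \in range (h n))
    (y * \1_(h n @^-1` [set y]) x)%:E * (g x)%:E)); last first.
  apply: eq_integral => x xE.
  rewrite -ge0_mule_fsuml => [|y]; last exact: nnfun_muleindic_ge0.
  by rewrite fsumEFin // -(fimfunE _ x).
rewrite ge0_integral_fsum//; last 2 first.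
- move=> y; apply: emeasurable_funM => //; apply/measurable_EFinP.
  exact: measurable_funM.
- move=> m y Ey; apply: mule_ge0; last by rewrite lee_fin.
  exact: nnfun_muleindic_ge0.
apply: eq_fsbigr => r rhn.
under eq_integral do rewrite EFinM.
rewrite integralZl_indic_nnsfun//.
under [RHS]eq_integral do rewrite EFinM -muleA.
rewrite ge0_integralZl//.
- congr (_ * _); rewrite integral_indic// setIT nuE// integral_mkcond.
  by apply: eq_integral => x _; rewrite epatch_indic muleC.
- by apply: emeasurable_funM => //; exact/measurable_EFinP.
- by move=> t Et; rewrite mule_ge0 ?lee_fin.
- by move: rhn; rewrite inE => -[t _ <-]; rewrite lee_fin.
Qed.

End density.

Lemma lebesgue_measureD (R : realType) (c : R) (A : set R) : measurable A ->
  lebesgue_measure ((fun x => x + c) @^-1` A) = lebesgue_measure A.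
Proof.
move=> mA.
pose f (x : R) : measurableTypeR R := x + c.
have mf : measurable_fun setT f by exact: measurable_funD.
apply/esym; rewrite -[RHS]/(pushforward lebesgue_measure f A).
apply: (lebesgue_measure_unique _ mA) => /= [_ [[a b]] _ <-].
rewrite /pushforward.
have -> : f @^-1` `]a, b] = `]a - c, b - c]%classic.
  by apply/seteqP; split=> x /=; rewrite !in_itv/= ltrBlDr lerBrDr.
rewrite !lebesgue_measure_itv/= !lte_fin ltrD2r -!EFinB.
by case: ifP => // _; congr EFin; ring.
Qed.

(** The density of N(c, 1) with respect to N(0, 1). *)
Definition gauss_ratio (R : realType) (c x : R) : R := expR (c * x - c ^+ 2 / 2).

Lemma measurable_gauss_ratio (R : realType) (c : R) :
  measurable_fun setT (gauss_ratio c).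
Proof.
apply: measurableT_comp => //; apply: measurable_funB => //.
Qed.

(** One-dimensional Cameron-Martin formula: translation invariance of Lebesgue measure replaces the
    density at [x] by the density at [y - c], whose quotient by the density at [y] is
    [gauss_ratio c y]. *)
Lemma normal_prob_shift (R : realType) (c : R) (A : set R) : measurable A ->
  normal_prob 0 1 ((fun x => x + c) @^-1` A) =
  (\int[normal_prob 0 1]_(x in A) (gauss_ratio c x)%:E)%E.
Proof.
move=> mA.
pose f (x : R) : measurableTypeR R := x + c.
have mf : measurable_fun setT f by exact: measurable_funD.
have mpdf (m : R) : measurable_fun setT (fun x => (normal_pdf m 1 x)%:E).
  by apply/measurable_EFinP; exact: measurable_normal_pdf.
have mgE : measurable_fun setT (fun x => (gauss_ratio c x)%:E).
  by apply/measurable_EFinP; exact: measurable_gauss_ratio.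
transitivity (\int[pushforward lebesgue_measure f]_(y in A)
    (normal_pdf 0 1 (y - c))%:E)%E.
  rewrite ge0_integral_pushforward//.
  - by apply: eq_integral => x _ /=; rewrite addrK.
  - apply: measurable_funTS; apply/measurable_EFinP.
    apply: measurableT_comp; first exact: measurable_normal_pdf.
    exact: measurable_funB.
  - by move=> x _; rewrite lee_fin normal_pdf_ge0.
transitivity (\int[lebesgue_measure]_(y in A) (normal_pdf 0 1 (y - c))%:E)%E.
  by apply: eq_measure_integral => //= B mB _; exact: lebesgue_measureD.
rewrite [LHS]integral_mkcond [RHS]integral_mkcond.
rewrite [RHS](@ge0_integral_density _ _ _ lebesgue_measure (normal_prob 0 1)
  (normal_pdf 0 1)); last 5 first.
- by move=> x; exact: normal_pdf_ge0.
- exact: measurable_normal_pdf.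
- by [].
- by apply/(measurable_restrictT _ mA); apply: measurable_funTS.
- by move=> x; rewrite erestrict_ge0// => y _; rewrite lee_fin expR_ge0.
apply: eq_integral => x _; rewrite !patchE; case: ifPn; rewrite ?mul0e// => _.
rewrite -EFinM; congr EFin.
rewrite !normal_pdfE ?oner_eq0// /gauss_ratio mulrCA; congr (_ * _).
rewrite /normal_fun -expRD; congr expR.
by rewrite expr1n; lra.
Qed.

(** * Induced measures, and the product sigma-algebra on the data *)

Section measures_from_functions.
Local Open Scope ereal_scope.
Context disp (T : measurableType disp) (R : realType).
Variable mu : {measure set T -> \bar R}.

Lemma density_measureP (g : T -> R) :
  (forall x, (0 <= g x)%R) -> measurable_fun setT g ->
  exists nu : {measure set T -> \bar R},
    forall A, nu A = \int[mu]_(x in A) (g x)%:E.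
Proof.
move=> g0 mg; pose nu A := \int[mu]_(x in A) (g x)%:E.
have nu0 : nu set0 = 0 by rewrite /nu integral_set0.
have nu_ge0 A : 0 <= nu A by apply: integral_ge0 => x _; rewrite lee_fin.
have nuS : semi_sigma_additive nu.
  by apply: semi_sigma_additive_nng_induced => //; exact/measurable_EFinP.
pose nu' : {measure set T -> \bar R} :=
  HB.pack nu (isMeasure.Build _ _ _ nu nu0 nu_ge0 nuS).
by exists nu'.
Qed.

Lemma pushforward_measureP disp' (T' : measurableType disp') (f : T -> T') :
  measurable_fun setT f ->
  exists nu : {measure set T' -> \bar R},
    (forall A, nu A = mu (f @^-1` A)) /\
    (forall F : T' -> \bar R, measurable_fun setT F -> (forall y, 0 <= F y) ->
      \int[nu]_y F y = \int[mu]_x F (f x)).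
Proof.
move=> mf; pose nu := pushforward mu f.
pose nu' : {measure set T' -> \bar R} := HB.pack nu.
exists (nu' mf); split => // F mF F0.
transitivity (\int[pushforward mu f]_y F y) => //.
by rewrite ge0_integral_pushforward.
Qed.

End measures_from_functions.

(** The generators [cylinders] over an arbitrary index type; at [obs_index d s] the two coincide by
    unfolding, so a selector is measurable on [dataT]. *)
Definition coord_sets (I : choiceType) (R : realType) : set (set (I -> R)) :=
  [set A | exists i (B : set R), measurable B /\ A = [set x | B (x i)]].

Notation dataT I R := (g_sigma_algebraType (@coord_sets I R)).

Section data_sigma_algebra.
Context (I : choiceType) (R : realType).

Lemma measurable_coord (i : I) :
  measurable_fun setT ((fun x => x i) : dataT I R -> R).
Proof.
move=> _ B mB; rewrite setTI; apply: sub_sigma_algebra.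
by exists i, B.
Qed.

Lemma measurable_to_data disp (T : measurableType disp) (f : T -> dataT I R) :
  (forall i, measurable_fun setT (fun t => f t i)) -> measurable_fun setT f.
Proof.
move=> mf; apply: (@measurability _ _ _ (dataT I R) setT f (@coord_sets I R)) => //.
move=> _ [_ [i [B [mB ->]]] <-]; rewrite setTI.
by have := mf i measurableT B mB; rewrite setTI.
Qed.

Definition box (J : seq I) (B : I -> set R) : set (dataT I R) :=
  [set x | forall i, i \in J -> B i (x i)].

Definition boxes : set (set (dataT I R)) :=
  [set A | exists J (B : I -> set R),
    (forall i, measurable (B i)) /\ A = box J B].

Lemma measurable_box J B : (forall i, measurable (B i)) -> measurable (box J B).
Proof.
move=> mB; elim: J => [|j J IH].
  by rewrite (_ : box _ _ = setT)//; apply/seteqP; split.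
have -> : box (j :: J) B = [set x : dataT I R | B j (x j)] `&` box J B.
  apply/seteqP; split=> x /=.
    move=> H; split; first by apply: H; rewrite mem_head.
    by move=> i iJ; apply: H; rewrite inE iJ orbT.
  by move=> [H1 H2] i /[!inE] /orP[/eqP->//|]; exact: H2.
apply: measurableI => //.
by have := @measurable_coord j measurableT _ (mB j); rewrite setTI.
Qed.

Lemma boxes_setI_closed : setI_closed boxes.
Proof.
move=> _ _ [J [B [mB ->]]] [J' [B' [mB' ->]]].
exists (J ++ J'), (fun i => (if i \in J then B i else setT) `&`
  (if i \in J' then B' i else setT)); split.
  by move=> i; apply: measurableI; case: ifP.
apply/seteqP; split=> x /=.
  by move=> [H H'] i _; split; case: ifPn => // ij; [exact: H|exact: H'].
move=> H; split=> i iJ.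
  by have := H i; rewrite mem_cat iJ /= => /(_ isT)[].
by have := H i; rewrite mem_cat iJ orbT => /(_ isT)[].
Qed.

(** Boxes form a pi-system that generates the sigma-algebra and contains the whole space; its finite
    mass lets the exhausting sequence be constant. *)
Lemma data_measure_unique (m1 m2 : {measure set (dataT I R) -> \bar R}) :
  (forall A, boxes A -> m1 A = m2 A) -> (m1 setT < +oo)%E ->
  forall A, measurable A -> m1 A = m2 A.
Proof.
move=> m12 m1y A mA.
have bT : boxes setT.
  exists [::], (fun=> setT); split; first by move=> _; exact: measurableT.
  by apply/seteqP; split.
apply: (measure_unique boxes (fun=> setT)) => //.
- apply/seteqP; split.
    apply: smallest_sub; first exact: smallest_sigma_algebra.
    move=> _ [i [B [mB ->]]]; apply: sub_sigma_algebra.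
    exists [:: i], (fun=> B); split => //.
    apply/seteqP; split=> x /=; first by move=> Bx j /[!inE]/eqP ->.
    by apply; rewrite mem_head.
  apply: smallest_sub; first exact: sigma_algebra_measurable.
  by move=> _ [J [B [mB ->]]]; exact: measurable_box.
- exact: boxes_setI_closed.
- by rewrite bigcup_const//; exists 0%N.
Qed.

End data_sigma_algebra.

(** * Change of measure for a shift of one noise coordinate *)

Section noise_shift.
Local Open Scope ereal_scope.
Context (R : realType) disp (Omega : measurableType disp).
Variables (P : probability Omega R) (I : choiceType) (xi : I -> {RV P >-> R}).
Hypothesis hxi : iid_std_normal xi.

Definition noise (w : Omega) : dataT I R := fun i => xi i w.

Lemma measurable_noise : measurable_fun setT noise.
Proof. by apply: measurable_to_data => i; exact: measurable_funP. Qed.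

Lemma noise_indep i J (C : set R) (B : I -> set R) :
  i \notin J -> measurable C -> (forall j, measurable (B j)) ->
  P ([set w | C (xi i w)] `&` noise @^-1` box J B) =
  normal_prob 0 1 C * P (noise @^-1` box J B).
Proof.
move=> iJ mC mB; have [ind law] := hxi.
have boxE J' B' : noise @^-1` box J' B' =
    \bigcap_(j in [set` undup J']) xi j @^-1` B' j.
  apply/seteqP; split=> w /= H j /=; rewrite ?mem_undup; first exact: H.
  by move=> jJ; apply: (H j) => /=; rewrite mem_undup.
pose B' j := if j == i then C else B j.
have mB' j : measurable (B' j) by rewrite /B'; case: ifP.
have -> : [set w | C (xi i w)] `&` noise @^-1` box J B =
    noise @^-1` box (i :: J) B'.
  apply/seteqP; split=> w /=.
    move=> [Cw Bw] j /[!inE]; rewrite /B'; case: eqVneq => [->//|_ /=].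
    exact: Bw.
  move=> H; split; first by have := H i (mem_head _ _); rewrite /B' eqxx.
  move=> j jJ; have := H j; rewrite inE jJ orbT => /(_ isT).
  by rewrite /B'; case: eqVneq => // ji; rewrite -ji jJ in iJ.
rewrite !boxE !ind ?undup_uniq// /= (negbTE iJ) big_cons; congr (_ * _).
  by rewrite /B' eqxx; exact: (law i C mC).
rewrite big_seq_cond [RHS]big_seq_cond; apply: eq_bigr => j.
rewrite mem_undup andbT /B'; case: eqVneq => // -> iJ'.
by rewrite iJ' in iJ.
Qed.

(** The two sides integrate [F] against the law [m1] of the shifted noise and the law [m2] of the
    noise under the tilted measure. These agree on boxes, where the constraint on coordinate [i]
    splits off by independence and [normal_prob_shift] applies to it. *)
Lemma noise_shift1 (i : I) (c : R) (F : dataT I R -> \bar R) :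
  measurable_fun setT F -> (forall x, 0 <= F x) ->
  \int[P]_w F (fun j => xi j w + (if j == i then c else 0))%R =
  \int[P]_w (F (noise w) * (gauss_ratio c (xi i w))%:E).
Proof.
move=> mF F0.
pose sh w : dataT I R := (fun j => xi j w + (if j == i then c else 0))%R.
have msh : measurable_fun setT sh.
  by apply: measurable_to_data => j; apply: measurable_funD => //.
have mg : measurable_fun setT (fun w => gauss_ratio c (xi i w)).
  by apply: measurableT_comp => //; exact: measurable_gauss_ratio.
have g0 w : (0 <= gauss_ratio c (xi i w))%R by exact: expR_ge0.
have [m1 [m1E m1F]] := pushforward_measureP P msh.
have [t tE] := density_measureP P g0 mg.
have [m2 [m2E m2F]] := pushforward_measureP t measurable_noise.
have m12 A : measurable A -> m1 A = m2 A.
  apply: data_measure_unique; last first.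
    rewrite m1E.
    exact: (le_lt_trans (@probability_le1 _ _ _ P setT measurableT) (ltry 1)).
  move=> _ [J [B [mB ->]]]; rewrite m1E m2E tE.
  pose J' := [seq j <- J | j != i].
  have iJ' : i \notin J' by rewrite mem_filter eqxx.
  (* A box that does not mention [i] puts the vacuous constraint [setT] on it. *)
  pose C := if i \in J then B i else setT.
  have mC : measurable C by rewrite /C; case: ifP.
  have boxE (f : Omega -> dataT I R) : f @^-1` box J B =
      [set w | C (f w i)] `&` f @^-1` box J' B.
    apply/seteqP; split=> w /=.
      move=> H; split; first by rewrite /C; case: ifPn => // /H.
      by move=> j; rewrite mem_filter => /andP[_]; exact: H.
    rewrite /C => -[H1 H2] j jJ; have [ji|ji] := eqVneq j i.
      by move: H1; rewrite -ji jJ.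
    by apply: H2; rewrite mem_filter ji.
  rewrite boxE [in RHS]boxE.
  have -> : sh @^-1` box J' B = noise @^-1` box J' B.
    apply/seteqP; split=> w /= H j jJ'; move: (H j jJ'); rewrite /sh;
      case: eqVneq jJ' iJ' => [-> ->//|_ _ _]; by rewrite addr0.
  rewrite /sh eqxx.
  have := noise_indep iJ' (C := (fun x => x + c)%R @^-1` C) _ mB.
  rewrite /= => -> ; last first.
    rewrite -[X in measurable X]setTI.
    by apply: (measurable_funD _ (measurable_cst c)) => //; exact: measurable_id.
  rewrite normal_prob_shift//.
  set E := noise @^-1` box J' B.
  have mE : measurable E.
    rewrite -[X in measurable X]setTI; apply: measurable_noise => //.
    exact: measurable_box.
  (* [q] is the law of [xi i] on the event [E]. Independence says that it is [P E] times the
     standard normal law, which factorises the integral of the density over the box without a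
     product measure. *)
  have [q [qE qF]] := @pushforward_measureP _ _ _ (mrestr P mE)
    _ (measurableTypeR R) _ (measurable_funPT (xi i)).
  pose G := (fun x => (gauss_ratio c x)%:E) \_ C.
  have mG : measurable_fun setT G.
    apply/(measurable_restrictT _ mC); apply: measurable_funTS.
    by apply/measurable_EFinP; exact: measurable_gauss_ratio.
  have G0 x : 0 <= G x.
    by rewrite erestrict_ge0// => y _; rewrite lee_fin expR_ge0.
  have PE : P E = (fine (P E))%:E by rewrite fineK// fin_num_measure.
  have qN (D : set R) : measurable D ->
      q D = \int[normal_prob 0 1]_(x in D) (fine (P E))%:E.
    move=> mD; rewrite integral_cst//= -PE qE muleC.
    exact: (noise_indep iJ' mD mB).
  have qG : \int[q]_x G x = (\int[normal_prob 0 1]_x G x) * P E.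
    rewrite (@ge0_integral_density _ _ _ (normal_prob 0 1) q
      (fun=> fine (P E)))//; last by move=> x; exact: fine_ge0.
    by rewrite -PE ge0_integralZr.
  have indE (D : set Omega) : measurable D ->
      mrestr P mE D = \int[P]_(x in D) (\1_E x)%:E.
    by move=> mD; rewrite integral_indic// setIC.
  rewrite [X in X * _]integral_mkcond -qG qF//.
  have mGx : measurable_fun setT (fun w => G (xi i w)).
    exact: measurableT_comp.
  rewrite (@ge0_integral_density _ _ _ P (mrestr P mE) \1_E)//.
  rewrite [RHS]integral_mkcond; apply: eq_integral => w _.
  rewrite !patchE indicE in_setI /G patchE.
  have -> : (w \in [set w | C (noise w i)]) = (xi i w \in C).
    by apply/idP/idP => /set_mem H; exact/mem_set.
  by case: (xi i w \in C); case: (w \in E); rewrite /= ?mule1 ?mule0 ?mul0e.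
transitivity (\int[m1]_x F x); first by rewrite m1F.
transitivity (\int[m2]_x F x).
  by apply: eq_measure_integral => A mA _; exact: m12.
rewrite m2F// (@ge0_integral_density _ _ _ P t (fun w => gauss_ratio c (xi i w)))//.
by apply: measurableT_comp => //; exact: measurable_noise.
Qed.

End noise_shift.

(** * Hyperbolic inequalities behind the entropy bound *)

Section hyperbolic.
Context (R : realType).
Implicit Types x y : R.

Lemma ge0_of_derive (f g : R -> R) :
  (forall x, is_derive x (1 : R) f (g x)) -> 0 <= f 0 ->
  (forall x, 0 <= x -> 0 <= g x) -> forall x, 0 <= x -> 0 <= f x.
Proof.
move=> fg f0 g0 x; rewrite le_eqVlt => /predU1P[<-//|x0].
have [c /andP[c0 _] fx] : exists2 c, 0 <= c <= x & f x - f 0 = g c * (x - 0).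
  have [|c] := @MVT_segment R f g 0 x (ltW x0) (fun c _ => fg c).
    apply: continuous_subspaceT => c.
    by apply/differentiable_continuous/derivable1_diffP; have [] := fg c.
  by rewrite in_itv/= => cx fE; exists c.
rewrite -(subrK (f 0) (f x)) fx subr0 addr_ge0// mulr_ge0 ?g0//; exact: ltW.
Qed.

Definition ch x : R := (expR x + expR (- x)) / 2.
Definition sh x : R := (expR x - expR (- x)) / 2.

Lemma ch_gt0 x : 0 < ch x.
Proof. by rewrite divr_gt0// addr_gt0 ?expR_gt0. Qed.

Lemma chN x : ch (- x) = ch x.
Proof. by rewrite /ch opprK addrC. Qed.

Lemma shN x : sh (- x) = - sh x.
Proof. by rewrite /sh opprK -mulNr opprB. Qed.

Lemma is_derive_expRN x : is_derive x (1 : R) (fun y => expR (- y)) (- expR (- x)).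
Proof. by apply: is_derive_eq; rewrite /GRing.scale/=; ring. Qed.

Lemma is_derive_ch x : is_derive x (1 : R) ch (sh x).
Proof.
have H := is_derive_expRN x.
rewrite /ch; apply: is_derive_eq; by rewrite /sh /GRing.scale/=; field.
Qed.

Lemma is_derive_sh x : is_derive x (1 : R) sh (ch x).
Proof.
have H := is_derive_expRN x.
rewrite /sh; apply: is_derive_eq; by rewrite /ch /GRing.scale/=; field.
Qed.

Lemma sh_ge0 x : 0 <= x -> 0 <= sh x.
Proof.
apply: (ge0_of_derive is_derive_sh); last by move=> *; exact/ltW/ch_gt0.
by rewrite /sh oppr0 subrr mul0r.
Qed.

Lemma ch_ge1D x : 0 <= x -> 1 + x ^+ 2 / 2 <= ch x.
Proof.
have D1 y : is_derive y (1 : R) (fun z => ch z - 1) (sh y).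
  by have H := is_derive_ch y; apply: is_derive_eq; ring.
have D2 y : is_derive y (1 : R) (fun z => sh z - z) (ch y - 1).
  by have H := is_derive_sh y; apply: is_derive_eq; ring.
have D3 y : is_derive y (1 : R) (fun z => ch z - 1 - z ^+ 2 / 2) (sh y - y).
  have H := is_derive_ch y; apply: is_derive_eq.
  by rewrite /GRing.scale/=; field.
have ch1 : ch 0 = 1 :> R by rewrite /ch oppr0 expR0; field.
have sh0 : sh 0 = 0 :> R by rewrite /sh oppr0 subrr mul0r.
move=> x0; rewrite -subr_ge0 opprD addrA.
apply: (ge0_of_derive D3) x x0; first by rewrite ch1; lra.
apply: (ge0_of_derive D2); first by rewrite sh0; lra.
apply: (ge0_of_derive D1); first by rewrite ch1; lra.
exact: sh_ge0.
Qed.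

(** At [x = 2 y] this is the sign of the derivative in [ln_ch_le]. The two sides agree to third
    order at 0, and three differentiations reduce the inequality to [0 <= y * sh y]. *)
Lemma mul_ch_ge x : 0 <= x -> 3 * sh x <= x * ch x + 2 * x.
Proof.
have D1 y : is_derive y (1 : R) (fun z => z * ch z - sh z) (y * sh y).
  have H := is_derive_sh y; have H' := is_derive_ch y; apply: is_derive_eq.
  by rewrite /GRing.scale/=; ring.
have D2 y : is_derive y (1 : R) (fun z => z * sh z - 2 * ch z + 2)
    (y * ch y - sh y).
  have H := is_derive_sh y; have H' := is_derive_ch y; apply: is_derive_eq.
  by rewrite /GRing.scale/=; ring.
have D3 y : is_derive y (1 : R) (fun z => z * ch z + 2 * z - 3 * sh z)
    (y * sh y - 2 * ch y + 2).
  have H := is_derive_sh y; have H' := is_derive_ch y; apply: is_derive_eq.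
  by rewrite /GRing.scale/=; ring.
have ch1 : ch 0 = 1 :> R by rewrite /ch oppr0 expR0; field.
have sh0 : sh 0 = 0 :> R by rewrite /sh oppr0 subrr mul0r.
move=> x0; rewrite -subr_ge0.
apply: (ge0_of_derive D3) x x0; first by rewrite sh0; lra.
apply: (ge0_of_derive D2); first by rewrite ch1; lra.
apply: (ge0_of_derive D1); first by rewrite sh0; lra.
by move=> y y0; rewrite mulr_ge0// sh_ge0.
Qed.

Lemma ch_double x : ch (x + x) = 2 * ch x ^+ 2 - 1.
Proof.
rewrite /ch opprD !expRD expRN; field.
by rewrite gt_eqF ?expR_gt0.
Qed.

Lemma sh_double x : sh (x + x) = 2 * sh x * ch x.
Proof.
rewrite /ch /sh opprD !expRD expRN; field.
by rewrite gt_eqF ?expR_gt0.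
Qed.

Lemma chsh x : ch x ^+ 2 - sh x ^+ 2 = 1.
Proof.
rewrite /ch /sh expRN; field.
by rewrite gt_eqF ?expR_gt0.
Qed.

(* The sharpness of the whole argument rests on the coefficient 1/4: for
   [x = h * (z + h)] with [z] standard normal the two terms on the right have
   means [h^2 / 4 + h^4 / 4] and [h^2 / 4], so that the entropy
   [ln (ch x) - h^2 / 2] of one sign-symmetrised coordinate has mean at most
   [h^4 / 4].  Bounding the entropy by the logarithm of the second moment of
   the likelihood ratio would only give [h^4 / 2]. *)
Lemma ln_ch_le x : ln (ch x) <= (x ^+ 2 + x * (sh x / ch x)) / 4.
Proof.
wlog x0 : x / 0 <= x.
  move=> H; have [/H//|x0] := leP 0 x.
  have /H : 0 <= - x by rewrite oppr_ge0 ltW.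
  by rewrite chN shN sqrrN mulNr mulNr mulrN opprK.
have D y : is_derive y (1 : R)
   (fun z => (z ^+ 2 + z * (sh z * (ch z)^-1)) / 4 - ln (ch z))
   ((2 * y + sh y / ch y + y / ch y ^+ 2) / 4 - sh y / ch y).
  have H := is_derive_sh y; have H' := is_derive_ch y.
  have c0 := ch_gt0 y; have cn0 : ch y != 0 by rewrite gt_eqF.
  have L := is_derive1_ln c0.
  have L' : is_derive y (1 : R) (fun z => ln (ch z)) (sh y / ch y).
    have := @is_derive1_comp R (@ln R) ch y _ _ L H'.
    by rewrite mulrC.
  have V : is_derive y (1 : R) (fun z => (ch z)^-1) (- (ch y) ^- 2 *: sh y).
    exact: is_deriveV.
  apply: is_derive_eq.
  (* The identity [chsh] is the only non-rational input; after it the two derivatives are equal as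
     rational expressions in [y], [ch y] and [sh y]. *)
  have -> : y / ch y ^+ 2 = y * (ch y ^+ 2 - sh y ^+ 2) / ch y ^+ 2.
    by rewrite chsh mulr1.
  by rewrite /GRing.scale/=; field.
rewrite -subr_ge0; apply: (ge0_of_derive D) x x0.
  have -> : ch 0 = 1 :> R by rewrite /ch oppr0 expR0; field.
  by rewrite ln1 subr0 mul0r addr0 expr0n/= mul0r.
move=> y y0; have c0 := ch_gt0 y.
have := mul_ch_ge (addr_ge0 y0 y0); rewrite ch_double sh_double => K.
have -> : (2 * y + sh y / ch y + y / ch y ^+ 2) / 4 - sh y / ch y =
  (2 * y * ch y ^+ 2 + y - 3 * (sh y * ch y)) / (4 * ch y ^+ 2).
  by field; rewrite gt_eqF.
by apply: divr_ge0; [lra | rewrite mulr_ge0// sqr_ge0].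
Qed.

End hyperbolic.

(** * The sign-averaged likelihood ratio: entropy and truncation *)

Section likelihood.
Context (R : realType) (L : nat).
Implicit Types (h x : 'I_L -> R) (t : {ffun 'I_L -> bool}).

Definition sgn (b : bool) : R := (-1) ^+ b.

Lemma sgn_sqr b : sgn b ^+ 2 = 1.
Proof. by rewrite /sgn sqrr_sign. Qed.

Definition lik t h x : R := \prod_(i < L) gauss_ratio (sgn (t i) * h i) (x i).

Lemma lik_gt0 t h x : 0 < lik t h x.
Proof. by apply: prodr_gt0 => i _; exact: expR_gt0. Qed.

Lemma sum_gauss_ratio (h x : R) :
  \sum_(b : bool) gauss_ratio (sgn b * h) x = 2 * ch (h * x) * expR (- (h ^+ 2 / 2)).
Proof.
rewrite big_bool /sgn/= /gauss_ratio /ch expr1 expr0 mul1r mulN1r sqrrN mulNr.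
by rewrite !expRD; field.
Qed.

Lemma sum_sgn_gauss_ratio (h x : R) :
  \sum_(b : bool) gauss_ratio (sgn b * h) x * sgn b =
  2 * ch (h * x) * expR (- (h ^+ 2 / 2)) * (sh (h * x) / ch (h * x)).
Proof.
rewrite big_bool /sgn/= /gauss_ratio /sh expr1 expr0 mul1r mulN1r sqrrN mulNr.
by rewrite !expRD; field; rewrite gt_eqF// ch_gt0.
Qed.

Lemma sum_lik h x : \sum_t lik t h x =
  \prod_(i < L) (2 * ch (h i * x i) * expR (- (h i ^+ 2 / 2))).
Proof.
rewrite /lik -(bigA_distr_bigA (fun i b => gauss_ratio (sgn b * h i) (x i)))/=.
by apply: eq_bigr => i _; rewrite sum_gauss_ratio.
Qed.

(** Under uniform signs the posterior given [x] is a product, and the posterior mean of sign [k] is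
    the hyperbolic tangent of [h k * x k]. *)
Lemma sum_lik_sgn h x (k : 'I_L) : \sum_t lik t h x * sgn (t k) =
  (\sum_t lik t h x) * (sh (h k * x k) / ch (h k * x k)).
Proof.
pose F i b := gauss_ratio (sgn b * h i) (x i) * (if i == k then sgn b else 1).
transitivity (\sum_(t : {ffun 'I_L -> bool}) \prod_(i < L) F i (t i)).
  apply: eq_bigr => t _; rewrite /F big_split/=; congr (_ * _).
  by rewrite -big_mkcond big_pred1_eq.
rewrite -(bigA_distr_bigA F) sum_lik.
transitivity (\prod_(i < L) (2 * ch (h i * x i) * expR (- (h i ^+ 2 / 2)) *
    (if i == k then sh (h i * x i) / ch (h i * x i) else 1))); last first.
  by rewrite big_split/=; congr (_ * _); rewrite -big_mkcond big_pred1_eq.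
apply: eq_bigr => i _; rewrite /F; case: eqVneq => _.
  by rewrite sum_sgn_gauss_ratio.
by under eq_bigr do rewrite mulr1; rewrite sum_gauss_ratio mulr1.
Qed.

(** The likelihood ratio [Lambda] of a needle. *)
Definition mixture h x : R := (\sum_t lik t h x) / 2 ^+ L.

Lemma mixture_gt0 h x : 0 < mixture h x.
Proof.
rewrite divr_gt0 ?exprn_gt0// sum_lik.
by apply: prodr_gt0 => i _; rewrite mulr_gt0 ?expR_gt0// mulr_gt0 ?ch_gt0.
Qed.

Lemma ln_mixture_le h x : ln (mixture h x) <=
  \sum_(i < L) (((h i * x i) ^+ 2 +
    (h i * x i) * (sh (h i * x i) / ch (h i * x i))) / 4 - h i ^+ 2 / 2).
Proof.
have -> : mixture h x = \prod_(i < L) (ch (h i * x i) * expR (- (h i ^+ 2 / 2))).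
  rewrite /mixture sum_lik; under eq_bigr do rewrite -mulrA.
  by rewrite big_split/= prodr_const card_ord mulrC mulKf// expf_neq0.
have -> : \prod_(i < L) (ch (h i * x i) * expR (- (h i ^+ 2 / 2))) =
    expR (\sum_(i < L) (ln (ch (h i * x i)) - h i ^+ 2 / 2)).
  rewrite expR_sum; apply: eq_bigr => i _.
  by rewrite expRD lnK// posrE ch_gt0.
rewrite expRK; apply: ler_sum => i _.
by rewrite lerD2r ln_ch_le.
Qed.

(** Completing the square: with [y = h x] and sign [s], [(y^2 + s y) / 4 - h^2 / 2] is a summand of
    [quad] minus a summand of [quad_shift]. Keeping the square apart leaves only nonnegative
    functions to integrate. *)
Definition quad t h x : R := \sum_(i < L) (h i * x i + sgn (t i) / 2) ^+ 2 / 4.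
Definition quad_shift h : R := \sum_(i < L) (16^-1 + h i ^+ 2 / 2).

(** The hyperbolic tangents in [ln_mixture_le] are posterior means of signs, so [sum_lik_sgn] trades
    them for the signs themselves. What remains is a quadratic polynomial weighted by [lik t h x],
    whose integral is a second moment of the shifted noise. *)
Lemma mixture_entropy h x : 2 ^+ L * (mixture h x * ln (mixture h x)) <=
  \sum_t lik t h x * (quad t h x - quad_shift h).
Proof.
rewrite mulrA {1}/mixture [X in X * _]mulrC divfK ?expf_neq0//.
pose y i := h i * x i.
have -> : \sum_t lik t h x * (quad t h x - quad_shift h) = (\sum_t lik t h x) *
    \sum_(i < L) ((y i ^+ 2 + y i * (sh (y i) / ch (y i))) / 4 - h i ^+ 2 / 2).
  rewrite mulr_sumr.
  under [RHS]eq_bigr => i _.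
    rewrite (_ : _ * _ = (\sum_t lik t h x) * (y i ^+ 2 / 4 - h i ^+ 2 / 2) +
      (\sum_t lik t h x) * (sh (y i) / ch (y i)) * (y i / 4)); last by ring.
    rewrite -sum_lik_sgn !mulr_suml -big_split/=.
    over.
  rewrite exchange_big/=; apply: eq_bigr => t _.
  rewrite /quad /quad_shift -sumrB mulr_sumr; apply: eq_bigr => i _.
  by rewrite sqrrD expr_div_n sgn_sqr -/(y i); field.
apply: ler_wpM2l; last exact: ln_mixture_le.
by apply: sumr_ge0 => t _; exact/ltW/lik_gt0.
Qed.

End likelihood.

Lemma mul_ln_ge (R : realType) (x : R) : 0 < x -> 0 <= x * ln x + 1.
Proof.
move=> x0.
have := @le_ln1Dx R (x^-1 - 1); rewrite [1 + _]addrC subrK lnV ?posrE// => H.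
have {}H : - ln x <= x^-1 - 1 by apply: H; rewrite ltrBrDr addNr invr_gt0.
have := ler_wpM2l (ltW x0) H.
by rewrite mulrN mulrBr divff ?gt_eqF//; lra.
Qed.

(** Above [T] one has [x <= x ln x / ln T]; the [+ 1] keeps the last term nonnegative for every [x],
    by [mul_ln_ge]. *)
Lemma le_trunc_entropy (R : realType) (T x : R) : 1 < T -> 0 < x ->
  x <= T + (x * ln x + 1) / ln T.
Proof.
move=> T1 x0; have lT : 0 < ln T by rewrite ln_gt0.
have [xT|Tx] := leP x T.
  apply: (le_trans xT); rewrite lerDl divr_ge0 ?(ltW lT)//.
  exact: mul_ln_ge.
have T0 : 0 < T by exact: lt_trans T1.
apply: (@le_trans _ _ (x * ln x / ln T)).
  rewrite -mulrA ler_peMr ?(ltW x0)// ler_pdivlMr// mul1r ler_ln ?posrE//.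
  exact: ltW.
by rewrite mulrDl mul1r addrA [T + _]addrC -addrA lerDl addr_ge0 ?invr_ge0 ?ltW.
Qed.

(** Here [b] stands for the indicator of an event. Multiplying [le_trunc_entropy] by [b] and
    inserting [mixture_entropy] gives the bound; [quad_shift] is moved to the left so that both
    sides are nonnegative and can be integrated term by term. *)
Lemma mixture_trunc (R : realType) (L : nat) (h x : 'I_L -> R) (T b : R) :
  1 < T -> 0 <= b <= 1 ->
  \sum_(t : {ffun 'I_L -> bool}) (b * lik t h x + quad_shift h / ln T * lik t h x) <=
  \sum_(t : {ffun 'I_L -> bool})
    (T * b + (ln T)^-1 + (ln T)^-1 * (lik t h x * quad t h x)).
Proof.
move=> T1 /andP[b0 b1]; have lT : 0 < ln T by rewrite ln_gt0.
set S := \sum_t lik t h x; set Q := \sum_t lik t h x * quad t h x.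
have cardE : #|{ffun 'I_L -> bool}|%:R = 2 ^+ L :> R.
  by rewrite card_ffun card_bool card_ord natrX.
have -> : \sum_t (b * lik t h x + quad_shift h / ln T * lik t h x) =
    b * S + quad_shift h / ln T * S.
  by rewrite big_split/= -!mulr_sumr.
have -> : \sum_(t : {ffun 'I_L -> bool})
    (T * b + (ln T)^-1 + (ln T)^-1 * (lik t h x * quad t h x)) =
    2 ^+ L * (T * b + (ln T)^-1) + (ln T)^-1 * Q.
  by rewrite big_split/= sumr_const -mulr_sumr -[in LHS]mulr_natl cardE.
have := mixture_entropy h x.
under eq_bigr do rewrite mulrBr.
rewrite sumrB -/Q -mulr_suml -/S => ent.
have SE : S = 2 ^+ L * mixture h x by rewrite /mixture mulrC divfK// expf_neq0.
have m0 := mixture_gt0 h x.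
have Z0 : 0 < 2 ^+ L :> R by rewrite exprn_gt0.
have lT0 : 0 < (ln T)^-1 by rewrite invr_gt0.
have tr := le_trunc_entropy T1 m0.
set m := mixture h x in ent SE m0 tr *.
have em : 0 <= m * ln m + 1 by exact: mul_ln_ge.
have bm : b * m <= T * b + (m * ln m + 1) / ln T.
  have := ler_wpM2l b0 tr; rewrite mulrDr [b * T]mulrC => H.
  apply: (le_trans H); rewrite lerD2l ler_piMl// divr_ge0//; exact: ltW.
have := ler_wpM2l (ltW Z0) bm; rewrite mulrCA -SE => {}bm.
have {}ent := ler_wpM2r (ltW lT0) ent.
rewrite -/m in ent; move: bm ent; rewrite !(mulrDr, mulrDl, mulrBl, mul1r, mulrA).
set il := (ln T)^-1; rewrite ![_ * S]mulrC; set Z := 2 ^+ L; lra.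
Qed.

(** * Shifts of finitely many coordinates and Gaussian moments *)

Section needle.
Local Open Scope ereal_scope.
Context (R : realType) disp (Omega : measurableType disp).
Variables (P : probability Omega R) (I : choiceType) (xi : I -> {RV P >-> R}).
Hypothesis hxi : iid_std_normal xi.

Definition shift (S : seq I) (m : I -> R) (x : dataT I R) : dataT I R :=
  fun j => (x j + (if j \in S then m j else 0))%R.

Lemma measurable_shift S m : measurable_fun setT (shift S m).
Proof.
apply: measurable_to_data => i; apply: measurable_funD => //.
exact: measurable_coord.
Qed.

Lemma noise_shift S (m : I -> R) (F : dataT I R -> \bar R) : uniq S ->
  measurable_fun setT F -> (forall x, 0 <= F x) ->
  \int[P]_w F (shift S m (noise xi w)) =
  \int[P]_w (F (noise xi w) * (\prod_(i <- S) gauss_ratio (m i) (xi i w))%:E).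
Proof.
elim: S F => [|i S IH] F; first move=> _ mF F0.
  apply: eq_integral => w _; rewrite big_nil mule1; congr F.
  by apply/funext => j; rewrite /shift addr0.
move=> /= /andP[iS uS] mF F0.
have -> : \int[P]_w F (shift (i :: S) m (noise xi w)) =
    \int[P]_w (F \o shift S m) (fun j => xi j w + (if j == i then m i else 0))%R.
  apply: eq_integral => w _ /=; congr F; apply/funext => j.
  rewrite /shift inE /noise; case: eqVneq => [->|_] /=.
    by rewrite (negbTE iS) addr0.
  by rewrite addr0.
rewrite (noise_shift1 hxi); last 2 first.
- by apply: measurableT_comp => //; exact: measurable_shift.
- by move=> x /=.
pose G (x : dataT I R) := F x * (gauss_ratio (m i) (x i))%:E.
transitivity (\int[P]_w G (shift S m (noise xi w))).
  apply: eq_integral => w _; rewrite /G /=; congr (_ * _).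
  by rewrite /shift (negbTE iS) addr0.
rewrite IH//; last 2 first.
- apply: emeasurable_funM => //; apply/measurable_EFinP.
  by apply: measurableT_comp; [exact: measurable_gauss_ratio|exact: measurable_coord].
- by move=> x; rewrite mule_ge0// lee_fin expR_ge0.
by apply: eq_integral => w _; rewrite big_cons /G -muleA -EFinM.
Qed.

(** The tilted law has total mass 1: this is [noise_shift1] for the constant function 1. *)
Lemma noise_mgf i c :
  \int[P]_w (expR (c * xi i w))%:E = (expR (c ^+ 2 / 2))%:E.
Proof.
have := noise_shift1 hxi i c (F := fun=> 1) (measurable_cst _) (fun=> lee01).
rewrite integral_cst//= probability_setT mul1e.
under eq_integral do rewrite mul1e /gauss_ratio expRD EFinM.
have mE : measurable_fun setT (fun w => (expR (c * xi i w))%:E).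
  by apply/measurable_EFinP; apply: measurableT_comp => //; exact: measurable_funM.
rewrite ge0_integralZr//; [|by move=> *; rewrite lee_fin expR_ge0..].
move=> H; have : (expR (c ^+ 2 / 2))%:E * 1 = (expR (c ^+ 2 / 2))%:E * 1 :> \bar R by [].
rewrite [in LHS]H muleCA -EFinM -expRD subrr expR0 !mule1.
by [].
Qed.

Lemma ch_ge (x : R) : (1 + x ^+ 2 / 2 <= ch x)%R.
Proof.
have [/ch_ge1D//|x0] := leP 0%R x.
by rewrite -sqrrN -chN; apply: ch_ge1D; rewrite oppr_ge0 ltW.
Qed.

(** An upper bound suffices, and [noise_mgf] gives it: [1 + (c x)^2 / 2 <= ch (c x)] and
    [1 + d x <= expR (d x)] dominate the square by exponentials of rate [c] and [-c], with an error
    of order [c], and [c] is arbitrarily small. *)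
Lemma noise_sqr i a b :
  \int[P]_w ((a * xi i w + b) ^+ 2)%:E <= (a ^+ 2 + b ^+ 2)%:E.
Proof.
set X := \int[P]_w _.
have mxi c : measurable_fun setT (fun w => expR (c * xi i w)).
  by apply: measurableT_comp => //; exact: measurable_funM.
have mxiE c : measurable_fun setT (fun w => (expR (c * xi i w))%:E).
  by apply/measurable_EFinP; exact: mxi.
have main (c : R) : (0 < c <= 1)%R ->
    X <= (a ^+ 2 + b ^+ 2 + c * (a ^+ 2 + 2 * `|a * b|))%:E.
  move=> /andP[c0 c1].
  pose K := (a ^+ 2 / c ^+ 2)%R; pose M := (2 * `|a * b| / c)%R.
  (* The sign of [d] follows that of [a * b], so that [M * (1 + d x) = M + 2 a b x] with [M]
     nonnegative. *)
  pose d := if (0 <= a * b)%R then c else (- c)%R.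
  have d2 : (d ^+ 2 = c ^+ 2)%R by rewrite /d; case: ifP => // _; rewrite sqrrN.
  have K0 : (0 <= K)%R by rewrite divr_ge0 ?sqr_ge0.
  have M0 : (0 <= M)%R by rewrite divr_ge0 ?mulr_ge0// ltW.
  have pw x : ((a * x + b) ^+ 2 + (2 * K + M) <=
      K * expR (c * x) + K * expR (- c * x) + M * expR (d * x) + b ^+ 2)%R.
    have H1 : (a ^+ 2 * x ^+ 2 + 2 * K <= K * expR (c * x) + K * expR (- c * x))%R.
      have := ler_wpM2l K0 (ch_ge (c * x)); rewrite /ch mulNr.
      have -> : (K * (1 + (c * x) ^+ 2 / 2) = K + (a ^+ 2 * x ^+ 2) / 2)%R.
        by rewrite /K; field; rewrite gt_eqF.
      lra.
    have H2 : (2 * (a * b) * x + M <= M * expR (d * x))%R.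
      have := ler_wpM2l M0 (expR_ge1Dx (d * x)).
      suff -> : (M * (1 + d * x) = 2 * (a * b) * x + M)%R by [].
      rewrite /M /d; case: (leP 0%R (a * b)%R) => ab.
        by rewrite ger0_norm//; field; rewrite gt_eqF.
      by rewrite ltr0_norm//; field; rewrite gt_eqF.
    by rewrite sqrrD exprMn; lra.
  have : \int[P]_w ((a * xi i w + b) ^+ 2 + (2 * K + M))%:E <=
      \int[P]_w (K * expR (c * xi i w) + K * expR (- c * xi i w) +
        M * expR (d * xi i w) + b ^+ 2)%:E.
    apply: ge0_le_integral => //.
    - by move=> w _; rewrite lee_fin !addr_ge0 ?sqr_ge0// mulr_ge0.
    - apply/measurable_EFinP; apply: measurable_funD => //.
      by apply: measurable_funX; apply: measurable_funD => //; exact: measurable_funM.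
    - apply/measurable_EFinP; apply: measurable_funD => //.
      by do 2?apply: measurable_funD; apply: measurable_funM => //; exact: mxi.
    - by move=> w _; rewrite lee_fin.
  have intE (k e : R) : (0 <= k)%R ->
      \int[P]_w (k * expR (e * xi i w))%:E = (k * expR (e ^+ 2 / 2))%:E.
    move=> k0; under eq_integral do rewrite EFinM.
    by rewrite ge0_integralZl_EFin// ?noise_mgf// => w _; rewrite lee_fin expR_ge0.
  have intC (k : R) : \int[P]_w k%:E = k%:E.
    by rewrite integral_cst//= probability_setT mule1.
  have mk (k e : R) : measurable_fun setT (fun w => (k * expR (e * xi i w))%:E).
    by apply/measurable_EFinP; apply: measurable_funM => //; exact: mxi.
  have p0 (k e y : R) : (0 <= k)%R -> 0 <= (k * expR (e * y))%:E.
    by move=> k0; rewrite lee_fin mulr_ge0// expR_ge0.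
  under eq_integral do rewrite EFinD.
  rewrite ge0_integralD//; last 3 first.
  - by move=> w _; rewrite lee_fin sqr_ge0.
  - apply/measurable_EFinP.
    by apply: measurable_funX; apply: measurable_funD => //; exact: measurable_funM.
  - by move=> w _; rewrite lee_fin addr_ge0// mulr_ge0.
  under [X in _ <= X -> _]eq_integral do rewrite !EFinD.
  rewrite ge0_integralD//; last 3 first.
  - by move=> w _; apply: adde_ge0; [apply: adde_ge0|]; exact: p0.
  - by do 2?apply: emeasurable_funD.
  - by move=> w _; rewrite lee_fin sqr_ge0.
  rewrite ge0_integralD//; last 3 first.
  - by move=> w _; apply: adde_ge0; exact: p0.
  - by apply: emeasurable_funD.
  - by move=> w _; exact: p0.
  rewrite ge0_integralD//; [|by move=> w _; exact: p0..].
  rewrite !intE// !intC sqrrN d2 -/X -!EFinD => H.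
  have {H} : X <= ((2 * K + M) * (expR (c ^+ 2 / 2) - 1) + b ^+ 2)%:E.
    rewrite (_ : (_ + _)%:E = (K * expR (c ^+ 2 / 2) + K * expR (c ^+ 2 / 2) +
      M * expR (c ^+ 2 / 2) + b ^+ 2)%:E - (2 * K + M)%:E); last first.
      by rewrite -EFinB; congr EFin; ring.
    by rewrite leeBrDr.
  move=> /le_trans; apply; rewrite lee_fin.
  set t := (c ^+ 2 / 2)%R.
  have t0 : (0 <= t)%R by rewrite divr_ge0 ?sqr_ge0.
  have c2 : (c ^+ 2 <= 1)%R by rewrite expr_le1// ltW.
  have t1 : (t <= 1 / 2)%R by rewrite /t; lra.
  have e1 : (expR t - 1 <= t * (1 + 2 * t))%R.
    have := expR_ge1Dx (- t)%R; rewrite expRN => E1.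
    have E0 := expR_gt0 t.
    have E2 : ((1 - t) * expR t <= 1)%R.
      by rewrite -ler_pdivlMr// div1r.
    have E3 : (1 <= (1 - t) * (1 + t * (1 + 2 * t)))%R.
      have -> : ((1 - t) * (1 + t * (1 + 2 * t)) = 1 + t ^+ 2 * (1 - 2 * t))%R by ring.
      by rewrite lerDl mulr_ge0 ?sqr_ge0//; lra.
    have := le_trans E2 E3; rewrite ler_pM2l; last by lra.
    lra.
  have KM0 : (0 <= 2 * K + M)%R by lra.
  have := ler_wpM2l KM0 e1.
  have -> : ((2 * K + M) * (t * (1 + 2 * t)) =
      (a ^+ 2 + `|a * b| * c) * (1 + c ^+ 2))%R.
    by rewrite /K /M /t; field; rewrite gt_eqF.
  have n0 : (0 <= `|a * b|)%R by [].
  have a0 : (0 <= a ^+ 2)%R by exact: sqr_ge0.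
  have cc : (c ^+ 2 <= c)%R by rewrite expr2 ler_piMl// ltW.
  have A1 := ler_wpM2l a0 cc.
  have A2 : (`|a * b| * c * c ^+ 2 <= `|a * b| * c)%R.
    by rewrite ler_piMr// mulr_ge0// ltW.
  have -> : ((a ^+ 2 + `|a * b| * c) * (1 + c ^+ 2) = a ^+ 2 + `|a * b| * c +
      a ^+ 2 * c ^+ 2 + `|a * b| * c * c ^+ 2)%R by ring.
  lra.
apply/lee_addgt0Pr => e e0.
pose C := (a ^+ 2 + 2 * `|a * b|)%R.
have C0 : (0 <= C)%R by rewrite addr_ge0 ?sqr_ge0// mulr_ge0.
have C1 : (0 < C + 1)%R by rewrite ltr_wpDl.
pose c := Num.min 1%R (e / (C + 1))%R.
have c0 : (0 < c)%R by rewrite lt_min ltr01 divr_gt0.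
apply: (le_trans (main c _)); first by rewrite c0 ge_min lexx.
rewrite -EFinD lee_fin lerD2l -/C.
have : (c * (C + 1) <= e)%R by rewrite -ler_pdivlMr// ge_min lexx orbT.
by apply: le_trans; rewrite ler_wpM2l// ?lerDl// ltW.
Qed.

End needle.

(** * The probability of recognising a needle *)

Section needle_bound.
Local Open Scope ereal_scope.
Context (R : realType) disp (Omega : measurableType disp).
Variables (P : probability Omega R) (I : choiceType) (xi : I -> {RV P >-> R}).
Hypothesis hxi : iid_std_normal xi.
Variables (S : seq I) (uS : uniq S).
Local Notation L := (size S).
Local Notation signs := {ffun 'I_(size S) -> bool}.

(** Signs are indexed by positions in [S]. The value 1 off [S] keeps every square equal to 1, so a
    change of signs never leaves the ellipsoid. *)
Definition sgs (t : signs) (j : I) : R :=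
  if insub (index j S) is Some i then sgn R (t i) else 1%R.

Lemma sgs_tnth t i : sgs t (tnth (in_tuple S) i) = sgn R (t i).
Proof.
rewrite /sgs (tnth_nth (tnth (in_tuple S) i)) index_uniq//.
by rewrite insubT//= => H; congr (sgn R (t _)); exact/val_inj.
Qed.

Lemma sgs_sqr t j : (sgs t j ^+ 2 = 1)%R.
Proof. by rewrite /sgs; case: insub => [i|]; rewrite ?sgn_sqr ?expr1n. Qed.

Definition signed (t : signs) (h : I -> R) : I -> R := fun j => (sgs t j * h j)%R.

(** Integrate [mixture_trunc] with the indicator of [B]. Under each sign vector the mean of [quad]
    is at most [quad_shift + D], so [quad_shift] cancels and the entropy bound [D] remains. *)
Lemma sum_prob_shift_le (T D : R) (h : I -> R) (B : set (dataT I R)) :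
  (1 < T)%R -> measurable B -> (\sum_(j <- S) h j ^+ 4 / 4 <= D)%R ->
  \sum_(t : signs) P (noise xi @^-1` (shift S (signed t h) @^-1` B)) <=
  (2 ^+ L)%:E * (T%:E * P (noise xi @^-1` B) + ((D + 1) / ln T)%:E).
Proof.
move=> T1 mB hD; have lT : (0 < ln T)%R by rewrite ln_gt0.
have lT0 : (0 <= (ln T)^-1)%R by rewrite invr_ge0 ltW.
pose tS (i : 'I_L) := tnth (in_tuple S) i.
pose H i := h (tS i).
pose X w i := xi (tS i) w.
have mnoiseB : measurable (noise xi @^-1` B).
  by rewrite -[X in measurable X]setTI; exact: measurable_noise.
have mX i : measurable_fun setT (fun w => X w i) by [].
pose l t w := lik t H (X w).
have ml t : measurable_fun setT (l t).
  apply: measurable_prod => i _; apply: measurableT_comp => //.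
  exact: measurable_gauss_ratio.
have l0 t w : (0 <= l t w)%R by exact/ltW/lik_gt0.
have lE t w : l t w = (\prod_(i <- S) gauss_ratio (signed t h i) (xi i w))%R.
  rewrite big_tnth; apply: eq_bigr => i _.
  by rewrite /signed sgs_tnth.
pose q t w := quad t H (X w).
have q0 t w : (0 <= q t w)%R.
  by apply: sumr_ge0 => i _; rewrite divr_ge0 ?sqr_ge0.
have mq t : measurable_fun setT (q t).
  apply: measurable_sum => i; apply: measurable_funM => //.
  by apply: measurable_funX; apply: measurable_funD => //; exact: measurable_funM.
pose b w : R := \1_(noise xi @^-1` B) w.
have mb : measurable_fun setT b by exact: measurable_indic.
have b01 w : (0 <= b w <= 1)%R by rewrite /b indicE; case: (_ \in _); rewrite /= ?lexx ?ler01.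
have b0 w : (0 <= b w)%R by case/andP: (b01 w).
have intb t : \int[P]_w (b w * l t w)%:E =
    P (noise xi @^-1` (shift S (signed t h) @^-1` B)).
  pose F := (fun x => (\1_B x)%:E) : dataT I R -> \bar R.
  have mF : measurable_fun setT F by apply/measurable_EFinP; exact: measurable_indic.
  have F0 x : 0 <= F x by rewrite lee_fin.
  have := noise_shift hxi (signed t h) uS mF F0.
  rewrite (_ : \int[P]_w F (shift _ _ _) =
    \int[P]_w (\1_(noise xi @^-1` (shift S (signed t h) @^-1` B)) w)%:E)//.
  rewrite integral_indic//; last first.
    rewrite -[X in measurable X]setTI; apply: measurable_noise => //.
    by rewrite -[X in measurable X]setTI; exact: measurable_shift.
  rewrite setIT => ->; apply: eq_integral => w _.
  by rewrite -lE /F /b !indicE EFinM.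
have intl t : \int[P]_w (l t w)%:E = 1.
  have := noise_shift hxi (signed t h) uS (F := fun=> 1) (measurable_cst _) (fun=> lee01).
  rewrite integral_cst//= probability_setT mul1e => ->.
  by apply: eq_integral => w _; rewrite mul1e lE.
have intlq t : \int[P]_w (l t w * q t w)%:E <= (quad_shift H + D)%:E.
  pose F : dataT I R -> \bar R := fun x => (quad t H (x \o tS))%:E.
  have mF : measurable_fun setT F.
    apply/measurable_EFinP; apply: measurable_sum => i; apply: measurable_funM => //.
    apply: measurable_funX; apply: measurable_funD => //.
    by apply: measurable_funM => //; exact: measurable_coord.
  have F0 x : 0 <= F x.
    by rewrite lee_fin; apply: sumr_ge0 => i _; rewrite divr_ge0 ?sqr_ge0.
  have := noise_shift hxi (signed t h) uS mF F0.
  rewrite (_ : \int[P]_w (F (noise xi w) * _) = \int[P]_w (l t w * q t w)%:E); last first.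
    by apply: eq_integral => w _; rewrite -lE -EFinM mulrC.
  move=> <-.
  pose s i := sgn R (t i).
  have FE w : F (shift S (signed t h) (noise xi w)) =
      \sum_(i < L) (4^-1 * (H i * X w i + s i * (H i ^+ 2 + 2^-1)) ^+ 2)%:E.
    rewrite /F /quad sumEFin; congr EFin; apply: eq_bigr => i _.
    rewrite /shift /= mem_tnth /signed sgs_tnth -/(s i) /noise -/(H i) -/(X w i).
    by rewrite [LHS]mulrC; congr (_ * _ ^+ 2)%R; ring.
  under eq_integral do rewrite FE.
  rewrite ge0_integral_sum//; last 2 first.
  - move=> i; apply/measurable_EFinP; apply: measurable_funM => //.
    by apply: measurable_funX; apply: measurable_funD => //; exact: measurable_funM.
  - by move=> i w _; rewrite lee_fin mulr_ge0 ?sqr_ge0.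
  apply: (@le_trans _ _ (\sum_(i < L)
      (4^-1 * (H i ^+ 2 + (s i * (H i ^+ 2 + 2^-1)) ^+ 2))%:E)).
    apply: lee_sum => i _; under eq_integral do rewrite EFinM.
    rewrite ge0_integralZl_EFin//; last 2 first.
    - by move=> w _; rewrite lee_fin sqr_ge0.
    - apply/measurable_EFinP.
      by apply: measurable_funX; apply: measurable_funD => //; exact: measurable_funM.
    by rewrite EFinM lee_wpmul2l ?lee_fin ?invr_ge0//; exact: (noise_sqr hxi).
  rewrite sumEFin lee_fin; apply: (@le_trans _ _ (quad_shift H +
      \sum_(i < L) H i ^+ 4 / 4)%R); last first.
    rewrite lerD2l; apply: le_trans hD.
    by rewrite [leRHS]big_tnth.
  (* Per coordinate, [(h^2 + (h^2 + 1/2)^2) / 4 = 1/16 + h^2 / 2 + h^4 / 4]: the first two terms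
     form [quad_shift]. *)
  rewrite /quad_shift -big_split/= ler_sum// => i _.
  by rewrite exprMn sgn_sqr mul1r le_eqVlt; apply/orP; left; apply/eqP; field.
have pw w : (\sum_t (b w * l t w + quad_shift H / ln T * l t w) <=
    \sum_(t : signs) (T * b w + (ln T)^-1 + (ln T)^-1 * (l t w * q t w)))%R.
  exact: mixture_trunc.
have a0 : (0 <= quad_shift H)%R.
  by apply: sumr_ge0 => i _; rewrite addr_ge0 ?divr_ge0 ?sqr_ge0.
have aT0 : (0 <= quad_shift H / ln T)%R by rewrite mulr_ge0.
have T0 : (0 <= T)%R by rewrite ltW// (lt_trans _ T1).
have mbl t : measurable_fun setT (fun w => b w * l t w)%R by exact: measurable_funM.
have mlq t : measurable_fun setT (fun w => l t w * q t w)%R by exact: measurable_funM.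
have : \int[P]_w (\sum_t ((b w * l t w)%:E + (quad_shift H / ln T * l t w)%:E)) <=
    \int[P]_w (\sum_(t : signs) ((T * b w)%:E + (ln T)^-1%:E + ((ln T)^-1 * (l t w * q t w))%:E)).
  apply: ge0_le_integral => //.
  - by move=> w _; apply: sume_ge0 => t _; rewrite -EFinD lee_fin addr_ge0 ?mulr_ge0.
  - apply: emeasurable_sum => t; apply: emeasurable_funD; apply/measurable_EFinP => //.
    exact: measurable_funM.
  - apply: emeasurable_sum => t; apply: emeasurable_funD; [apply: emeasurable_funD|];
      apply/measurable_EFinP => //; exact: measurable_funM.
  - move=> w _; under eq_bigr do rewrite -EFinD.
    under [X in _ <= X]eq_bigr do rewrite -!EFinD.
    by rewrite !sumEFin lee_fin.
pose pt t := P (noise xi @^-1` (shift S (signed t h) @^-1` B)).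
rewrite ge0_integral_sum//; last 2 first.
- move=> t; apply: emeasurable_funD; apply/measurable_EFinP => //.
  exact: measurable_funM.
- by move=> t w _; rewrite -EFinD lee_fin addr_ge0 ?mulr_ge0.
have -> : \sum_t \int[P]_w ((b w * l t w)%:E + (quad_shift H / ln T * l t w)%:E) =
    \sum_t (pt t + (quad_shift H / ln T)%:E).
  apply: eq_bigr => t _; rewrite ge0_integralD//; last 4 first.
  - by move=> w _; rewrite lee_fin mulr_ge0.
  - exact/measurable_EFinP.
  - by move=> w _; rewrite lee_fin mulr_ge0.
  - by apply/measurable_EFinP; exact: measurable_funM.
  rewrite intb; congr (_ + _); under eq_integral do rewrite EFinM.
  rewrite ge0_integralZl_EFin ?intl ?mule1//.
  - by move=> w _; rewrite lee_fin.
  - exact/measurable_EFinP.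
rewrite ge0_integral_sum//; last 2 first.
- move=> t; apply: emeasurable_funD; [apply: emeasurable_funD|];
    apply/measurable_EFinP => //; exact: measurable_funM.
- by move=> t w _; rewrite -!EFinD lee_fin !addr_ge0 ?mulr_ge0.
move=> main; have {main} : \sum_t (pt t + (quad_shift H / ln T)%:E) <=
    \sum_(t : signs) (T%:E * P (noise xi @^-1` B) + (ln T)^-1%:E +
      ((ln T)^-1 * (quad_shift H + D))%:E).
  apply: (le_trans main); apply: lee_sum => t _.
  rewrite ge0_integralD//; last 4 first.
  - by move=> w _; rewrite -EFinD lee_fin addr_ge0 ?mulr_ge0.
  - by apply: emeasurable_funD => //; apply/measurable_EFinP; exact: measurable_funM.
  - by move=> w _; rewrite lee_fin !mulr_ge0.
  - by apply/measurable_EFinP; exact: measurable_funM.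
  rewrite ge0_integralD//; [|first [by move=> w _; rewrite lee_fin mulr_ge0|
    by apply/measurable_EFinP; exact: measurable_funM]..].
  apply: leeD; [apply: leeD|].
  - under eq_integral do rewrite EFinM.
    rewrite ge0_integralZl_EFin//; last 2 first.
    + by move=> w _; rewrite lee_fin.
    + exact/measurable_EFinP.
    by rewrite /b integral_indic// setIT.
  - by rewrite integral_cst//= probability_setT mule1.
  - under eq_integral do rewrite EFinM.
    rewrite ge0_integralZl_EFin//; last 2 first.
    + by move=> w _; rewrite lee_fin mulr_ge0.
    + exact/measurable_EFinP.
    by rewrite [leRHS]EFinM lee_wpmul2l.
rewrite -[X in _ -> X <= _]/(\sum_t pt t).
(* Passing to real numbers allows the [quad_shift / ln T] terms to be cancelled. *)
have -> : P (noise xi @^-1` B) = (fine (P (noise xi @^-1` B)))%:E.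
  by rewrite fineK// fin_num_measure.
have ptE t : pt t = (fine (pt t))%:E.
  rewrite fineK// fin_num_measure//.
  rewrite -[X in measurable X]setTI; apply: measurable_noise => //.
  by rewrite -[X in measurable X]setTI; exact: measurable_shift.
under eq_bigr do rewrite ptE.
under [X in _ -> X <= _]eq_bigr do rewrite ptE.
rewrite -EFinM; under eq_bigr do rewrite -EFinD.
under [X in _ <= X -> _]eq_bigr do rewrite -!EFinD.
rewrite !sumEFin -EFinD -EFinM !lee_fin.
rewrite big_split/= !sumr_const.
rewrite -[X in (_ + X <= _ -> _)%R]mulr_natl -[X in (_ <= X -> _)%R]mulr_natl.
rewrite card_ffun card_bool card_ord natrX -lerBrDr => /le_trans; apply.
rewrite -mulrBr ler_wpM2l ?exprn_ge0//.
by rewrite le_eqVlt; apply/orP; left; apply/eqP; ring.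
Qed.

(* Since the events are disjoint, the linear term of the previous bound is
   counted only once for the whole family of needles. *)
Lemma needle_bound (V : finType) (T D : R) (h : V -> I -> R)
    (B : V -> set (dataT I R)) :
  (1 < T)%R -> (forall v, measurable (B v)) ->
  (forall v v' x, B v x -> B v' x -> v = v') ->
  (forall v, \sum_(j <- S) h v j ^+ 4 / 4 <= D)%R ->
  \sum_(v : V) \sum_(t : signs)
    P (noise xi @^-1` (shift S (signed t (h v)) @^-1` B v)) <=
  (2 ^+ L * (T + #|V|%:R * ((D + 1) / ln T)))%:E.
Proof.
move=> T1 mB dB hD.
apply: (@le_trans _ _ (\sum_(v : V) ((2 ^+ L)%:E *
    (T%:E * P (noise xi @^-1` B v) + ((D + 1) / ln T)%:E)))).
  by apply: lee_sum => v _; exact: sum_prob_shift_le.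
have mN v : measurable (noise xi @^-1` B v).
  by rewrite -[X in measurable X]setTI; exact: measurable_noise.
have PE v : P (noise xi @^-1` B v) = (fine (P (noise xi @^-1` B v)))%:E.
  by rewrite fineK// fin_num_measure.
have sum1 : (\sum_(v : V) fine (P (noise xi @^-1` B v)) <= 1)%R.
  rewrite -lee_fin -sumEFin; under eq_bigr do rewrite -PE.
  rewrite (fsbig_seq _ _ (index_enum_uniq V)) -measure_fin_bigcup.
  - by apply: probability_le1; apply: fin_bigcup_measurable.
  - exact: finite_seq.
  - by move=> v v' _ _ [w [/= Bv Bv']]; exact: dB Bv Bv'.
  - by [].
rewrite (eq_bigr (fun v => (2 ^+ L *
  (T * fine (P (noise xi @^-1` B v)) + (D + 1) / ln T))%:E)); last first.
  by move=> v _; rewrite [in LHS]PE.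
rewrite sumEFin lee_fin -mulr_sumr ler_wpM2l ?exprn_ge0//.
rewrite big_split/= -mulr_sumr; apply: lerD.
  by rewrite ler_piMr// ltW// (lt_trans _ T1).
by rewrite sumr_const -[leLHS]mulr_natl.
Qed.

End needle_bound.

(** * Nearly extremal points of the ellipsoid with finite support *)

Section esum_finite.
Local Open Scope ereal_scope.
Context (R : realType) (T : choiceType) (A : set T) (f : T -> R).
Hypothesis f0 : forall l, (0 <= f l)%R.

Lemma esum_finite_support (S : seq T) : uniq S -> [set` S] `<=` A ->
  (forall l, l \notin S -> f l = 0%R) ->
  \esum_(l in A) (f l)%:E = (\sum_(l <- S) f l)%R%:E.
Proof.
move=> uS SA fS.
rewrite (esumID [set` S]); last by move=> *; rewrite lee_fin.
rewrite setIidr// [X in _ + X]esum1 ?adde0; last first.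
  by move=> l [_ /negP lS]; rewrite fS.
rewrite esum_fset; [|exact: finite_seq|by move=> *; rewrite lee_fin].
by rewrite -fsbig_seq// sumEFin.
Qed.

Lemma sum_le_esum (S : seq T) : uniq S -> [set` S] `<=` A ->
  (\sum_(l <- S) f l)%R%:E <= \esum_(l in A) (f l)%:E.
Proof.
move=> uS SA; apply: esum_ge; exists [set` S].
  by split => //; exact: finite_seq.
by rewrite -fsbig_seq// sumEFin.
Qed.

Lemma lt_esum (x : R) : x%:E < \esum_(l in A) (f l)%:E ->
  exists S : seq T, [/\ uniq S, [set` S] `<=` A & (x < \sum_(l <- S) f l)%R].
Proof.
move=> /ereal_sup_gt[_ [X [finX XA] <-]].
rewrite fsbig_finite// sumEFin lte_fin => xS.
exists (finmap.enum_fset (fset_set X)); split => //.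
by move=> l /=; rewrite in_fset_set// => /set_mem/XA.
Qed.

End esum_finite.

Section finite_support_theta.
Context (R : realType) (sigma e : R) (d : nat) (u : {set 'I_d}).
Hypotheses (e0 : 0 < e) (u0 : (0 < #|u|)%N).

Definition ind_freq : freq d := [ffun j => (j \in u)%:Z].

Lemma Zring_ind_freq : Zring u ind_freq.
Proof. by move=> j; rewrite ffunE; case: (j \in u). Qed.

(** The radius at which a point mass at [ind_freq] meets the boundary of the ellipsoid, and the
    upper limit imposed on the radii. *)
Definition max_radius : R := (2 * pi) `^ (- sigma) * #|u|%:R `^ (- (sigma / 2)).

Lemma max_radius_gt0 : 0 < max_radius.
Proof. by rewrite mulr_gt0// powR_gt0 ?mulr_gt0 ?pi_gt0// ltr0n. Qed.

Lemma csq_ind_freq : max_radius ^+ 2 * csq sigma ind_freq = 1.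
Proof.
have p0 : 0 < 2 * pi :> R by rewrite mulr_gt0// pi_gt0.
have k0 : 0 < #|u|%:R :> R by rewrite ltr0n.
have -> : csq sigma ind_freq = ((2 * pi) ^+ 2 * #|u|%:R) `^ sigma :> R.
  congr (_ `^ _); rewrite (eq_bigr (fun j => (2 * pi) ^+ 2 * (j \in u)%:R)).
    rewrite -mulr_sumr -natr_sum; congr (_ * _%:R).
    by rewrite -sum1_card [RHS]big_mkcond/=; apply: eq_bigr => j _; case: (j \in u).
  by move=> j _; rewrite ffunE exprMn; case: (j \in u); rewrite /= ?expr1n ?expr0n.
rewrite powRM ?sqr_ge0 ?(ltW k0)//.
rewrite -[(2 * pi) ^+ 2]powR_mulrn ?(ltW p0)// -powRrM /max_radius exprMn.
rewrite -!powR_mulrn ?powR_ge0// -!powRrM mulrACA -!powRD ?(gt_eqF p0) ?(gt_eqF k0) ?implybT//.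
rewrite (_ : - sigma * 2%:R + 2%:R * sigma = 0); last by ring.
rewrite (_ : - (sigma / 2) * 2%:R + sigma = 0); last by field.
by rewrite !powRr0 mul1r.
Qed.

(* Mixing in a little of the extreme point concentrated at [ind_freq] pays for
   the tail that is cut off. *)
Lemma finite_support_theta (r b : R) :
  0 < r < max_radius -> detect sigma e u r ^+ 2 < b ->
  exists (theta : freq d -> R) (S : seq (freq d)),
    [/\ uniq S, [set` S] `<=` Zring u, Theta_ring sigma r u theta &
        (forall l, l \notin S -> theta l = 0) /\
        \sum_(l <- S) theta l ^+ 4 <= 2 * e ^+ 4 * b].
Proof.
move=> /andP[r0 rrho] hb; pose rho := max_radius; pose l0 := ind_freq.
have rho0 : 0 < rho := max_radius_gt0.
have c0 (l : freq d) : 0 <= csq sigma l :> R by exact: powR_ge0.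
have e40 : 0 < 2 * e ^+ 4 by rewrite mulr_gt0// exprn_gt0.
have r2 : r ^+ 2 < rho ^+ 2 by rewrite ltr_pXn2r// nnegrE ltW.
set J := ereal_inf [set (\esum_(l in Zring u) (theta l ^+ 4)%:E)%E
                    | theta in Theta_ring sigma r u].
have J0 : (0 <= J)%E.
  apply: le_ereal_inf_tmp => _ [th _ <-].
  by apply: esum_ge0 => l _; rewrite lee_fin exprn_even_ge0.
(* The mass [rho] at [l0] is admissible, so the infimum is finite and [fine] in [detect] loses
   nothing. *)
have Jy : (J <= (rho ^+ 4)%:E)%E.
  pose th l := if l == l0 then rho else 0.
  have su (f : freq d -> R) : (forall l, 0 <= f l) -> (forall l, l != l0 -> f l = 0) ->
      (\esum_(l in Zring u) (f l)%:E)%E = (f l0)%:E.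
    move=> f0 f1; rewrite (@esum_finite_support _ _ _ _ f0 [:: l0])//.
    - by rewrite big_seq1.
    - by move=> l /=; rewrite inE => /eqP ->; exact: Zring_ind_freq.
    - by move=> l; rewrite inE; exact: f1.
  apply: ge_ereal_inf; exists (\esum_(l in Zring u) (th l ^+ 4)%:E)%E.
    exists th => //; split.
      rewrite su; first by rewrite /th eqxx csq_ind_freq.
      - by move=> l; rewrite mulr_ge0 ?sqr_ge0.
      - by move=> l /negPf ll0; rewrite /th ll0 expr0n mul0r.
    rewrite su; first by rewrite /th eqxx lee_fin ltW.
    - by move=> l; rewrite sqr_ge0.
    - by move=> l /negPf ll0; rewrite /th ll0 expr0n.
  rewrite su; first by rewrite /th eqxx.
  - by move=> l; rewrite exprn_even_ge0.
  - by move=> l /negPf ll0; rewrite /th ll0 expr0n.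
have Jfin : J \is a fin_num.
  by rewrite ge0_fin_numE//; apply: (le_lt_trans Jy); exact: ltry.
have {hb} JY : (J < (2 * e ^+ 4 * b)%:E)%E.
  rewrite -(fineK Jfin) lte_fin; move: hb.
  rewrite /detect -/J sqr_sqrtr; last first.
    by rewrite mulr_ge0 ?invr_ge0 ?(ltW e40)// fine_ge0.
  by rewrite mulrC ltr_pdivrMr// mulrC.
set Y := 2 * e ^+ 4 * b in JY *.
have [_ [th [th1 th2] <-] thY] := ereal_inf_lt JY.
have X0 : (0 <= \esum_(l in Zring u) (th l ^+ 4)%:E)%E.
  by apply: esum_ge0 => l _; rewrite lee_fin exprn_even_ge0.
have Xfin : (\esum_(l in Zring u) (th l ^+ 4)%:E)%E \is a fin_num.
  by rewrite ge0_fin_numE//; apply: (lt_trans thY); exact: ltry.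
pose X := fine (\esum_(l in Zring u) (th l ^+ 4)%:E)%E.
have XE : (\esum_(l in Zring u) (th l ^+ 4)%:E)%E = X%:E by rewrite fineK.
have {}X0 : 0 <= X by rewrite -lee_fin -XE.
have XY : X < Y by rewrite -lte_fin -XE.
have rho4 : 0 < rho ^+ 4 by rewrite exprn_gt0.
(* The weight of the extreme point: small enough that the added [la * rho ^+ 4] fits into the slack
   [Y - X]. *)
pose la := Num.min 2^-1 ((Y - X) / (rho ^+ 4 + 1)).
have la0 : 0 < la by rewrite lt_min invr_gt0 ltr0n/= divr_gt0 ?subr_gt0// addr_gt0.
have la1 : la <= 2^-1 by rewrite ge_min lexx.
have laY : la * (rho ^+ 4 + 1) <= Y - X.
  by rewrite -ler_pdivlMr ?addr_gt0// ge_min lexx orbT.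
(* The permitted loss is what the extreme point repays: [(1 - la) (r^2 - la (rho^2 - r^2)) + la
   rho^2 = r^2 + la^2 (rho^2 - r^2)]. *)
have [F [uF FA Fr]] : exists F : seq (freq d), [/\ uniq F, [set` F] `<=` Zring u &
    r ^+ 2 - la * (rho ^+ 2 - r ^+ 2) < \sum_(l <- F) th l ^+ 2].
  apply: lt_esum.
  by apply: lt_le_trans th2; rewrite lte_fin ltrBlDr ltrDl mulr_gt0 ?subr_gt0.
pose S := undup (l0 :: F).
have uS : uniq S by exact: undup_uniq.
have l0S : l0 \in S by rewrite mem_undup mem_head.
have SA : [set` S] `<=` Zring u.
  move=> l /=; rewrite mem_undup inE => /orP[/eqP ->|/FA//].
  exact: Zring_ind_freq.
have FS : \sum_(l <- F) th l ^+ 2 <= \sum_(l <- S) th l ^+ 2.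
  rewrite /S /=; case: ifPn => l0F; first by rewrite undup_id.
  by rewrite undup_id// big_cons lerDr sqr_ge0.
pose a l := th l ^+ 2; pose c l := if l == l0 then rho ^+ 2 else 0.
have a0 l : 0 <= a l by exact: sqr_ge0.
have cc0 l : 0 <= c l by rewrite /c; case: ifP => // _; exact: sqr_ge0.
have sumc (f : freq d -> R) : \sum_(l <- S) (if l == l0 then f l else 0) = f l0.
  rewrite (bigD1_seq l0)//= eqxx big1 ?addr0// => l /negPf ll0.
  by rewrite ll0.
(* Squares are mixed, not the points themselves: both constraints are linear in the squares, and the
   sum of fourth powers is convex in them. *)
pose t2 l := if l \in S then (1 - la) * a l + la * c l else 0.
have la1' : 0 <= 1 - la by lra.
have t20 l : 0 <= t2 l.
  rewrite /t2; case: ifP => // _.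
  by apply: addr_ge0; apply: mulr_ge0 => //; exact: ltW.
pose t l := Num.sqrt (t2 l).
have tt l : t l ^+ 2 = t2 l by rewrite sqr_sqrtr.
have tS l : l \notin S -> t l = 0 by move=> /negPf lS; rewrite /t /t2 lS sqrtr0.
have sumt (f : freq d -> R) : \sum_(l <- S) t l ^+ 2 * f l =
    (1 - la) * (\sum_(l <- S) a l * f l) + la * (rho ^+ 2 * f l0).
  rewrite -(sumc (fun l => rho ^+ 2 * f l)) !mulr_sumr -big_split/=.
  rewrite big_seq [RHS]big_seq; apply: eq_bigr => l lS.
  by rewrite tt /t2 lS /c; case: ifP => _; ring.
exists t, S; split => //; last split => //.
- split.
    rewrite (@esum_finite_support _ _ _ _ _ S)//; last 2 first.
    + by move=> l; rewrite mulr_ge0 ?sqr_ge0.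
    + by move=> l lS; rewrite tS// expr0n mul0r.
    rewrite lee_fin sumt csq_ind_freq mulr1.
    have : \sum_(l <- S) a l * csq sigma l <= 1.
      rewrite -lee_fin; apply: le_trans th1.
      apply: (@sum_le_esum _ _ _ (fun l => a l * csq sigma l))=> //.
    by move=> /(ler_wpM2l la1'); lra.
  rewrite (@esum_finite_support _ _ _ _ _ S)//; last 2 first.
  + by move=> l; rewrite sqr_ge0.
  + by move=> l lS; rewrite tS// expr0n.
  rewrite lee_fin; have := sumt (fun=> 1).
  under eq_bigr do rewrite mulr1.
  under [X in _ = _ * X + _ -> _]eq_bigr do rewrite mulr1.
  move=> ->; rewrite mulr1.
  have := ler_wpM2l la1' (le_trans (ltW Fr) FS).
  have : 0 <= la * la * (rho ^+ 2 - r ^+ 2).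
    by rewrite mulr_ge0 ?mulr_ge0 ?(ltW la0)// subr_ge0 ltW.
  by rewrite -/a; lra.
- have tq l : l \in S -> t l ^+ 4 <=
      (1 - la) * th l ^+ 4 + la * (if l == l0 then rho ^+ 4 else 0).
    move=> lS; have -> : t l ^+ 4 = t2 l ^+ 2 by rewrite -tt -exprM.
    rewrite /t2 lS; have -> : th l ^+ 4 = a l ^+ 2 by rewrite /a -exprM.
    have -> : (if l == l0 then rho ^+ 4 else 0) = c l ^+ 2.
      by rewrite /c; case: ifP; rewrite ?expr0n// -exprM.
    rewrite -subr_ge0.
    have -> : (1 - la) * a l ^+ 2 + la * c l ^+ 2 - ((1 - la) * a l + la * c l) ^+ 2
      = (1 - la) * la * (a l - c l) ^+ 2 by ring.
    by rewrite mulr_ge0 ?sqr_ge0// mulr_ge0// ltW.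
  apply: (@le_trans _ _ (\sum_(l <- S) ((1 - la) * th l ^+ 4 +
      la * (if l == l0 then rho ^+ 4 else 0)))).
    by rewrite big_seq [leRHS]big_seq; apply: ler_sum => l lS; exact: tq.
  rewrite big_split/= -!mulr_sumr (sumc (fun=> rho ^+ 4)).
  have : \sum_(l <- S) th l ^+ 4 <= X.
    rewrite -lee_fin -XE.
    apply: (@sum_le_esum _ _ _ (fun l => th l ^+ 4))=> //.
  move=> /(ler_wpM2l la1').
  have : 0 <= la * (X + 1) by rewrite mulr_ge0 ?(ltW la0)// addr_ge0.
  by move: laY; lra.
Qed.

End finite_support_theta.

(** * Averaging over finite configurations *)

Section averaging.
Context (R : realType) (B X : finType).

Definition upd (f : {ffun B -> X}) (b : B) (x : X) : {ffun B -> X} :=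
  [ffun b' => if b' == b then x else f b'].

(* Swapping the coordinate [b] of [f] with [x] is an involution of the pairs
   [(f, x)]. *)
Lemma sum_upd (b : B) (g : {ffun B -> X} -> R) :
  \sum_f \sum_x g (upd f b x) = #|X|%:R * \sum_f g f.
Proof.
rewrite pair_big/=.
pose h (p : {ffun B -> X} * X) := (upd p.1 b p.2, p.1 b).
have hK : involutive h.
  move=> [f x]; rewrite /h /=; congr pair; last by rewrite ffunE eqxx.
  by apply/ffunP => b'; rewrite !ffunE; case: eqVneq => [->|].
rewrite (reindex_inj (inv_inj hK))/=.
rewrite (eq_bigr (fun p : {ffun B -> X} * X => g p.1)); last first.
  move=> [f x] _ /=; congr g; apply/ffunP => b'; rewrite !ffunE.
  by case: eqVneq => [->|].
rewrite -(pair_big xpredT xpredT (fun f _ => g f))/= mulr_sumr.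
by apply: eq_bigr => f _; rewrite sumr_const mulr_natl.
Qed.

(** The hypothesis bounds each block conditionally on the others. By [sum_upd] the same bound holds
    on average over all configurations, and some configuration does not exceed the average; [x0]
    makes the average one over a nonempty set. *)
Lemma exists_sum_le (g : B -> {ffun B -> X} -> R) (C : R) (x0 : X) :
  (forall b f, \sum_x g b (upd f b x) <= #|X|%:R * C) ->
  exists f, \sum_b g b f <= #|B|%:R * C.
Proof.
move=> gC; apply: contrapT => /forallNP H.
have X0 : 0 < #|X|%:R :> R by rewrite ltr0n; apply/card_gt0P; exists x0.
have c0 : (0 < #|{ffun B -> X}|)%N by apply/card_gt0P; exists [ffun=> x0].
have : \sum_f \sum_b g b f <= #|{ffun B -> X}|%:R * (#|B|%:R * C).
  rewrite exchange_big/= mulrCA mulr_natl -sumr_const; apply: ler_sum => b _.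
  rewrite -(ler_pM2l X0) -(sum_upd b) [leRHS]mulrCA mulr_natl -sumr_const.
  by apply: ler_sum => f _; exact: gC.
apply/negP; rewrite -ltNge mulr_natl -sumr_const.
apply: ltr_sum; last by move=> f _; rewrite ltNge; exact/negP/H.
by apply/hasP; exists [ffun=> x0]; rewrite ?mem_index_enum.
Qed.

End averaging.

(** * Risk of a selector over the block configurations *)

Section risk_lower_bound.
Context (R : realType) (beta eps : R) (d s k : nat).
Context (disp : measure_display) (Omega : measurableType disp).
Context (P : probability Omega R) (xi : obs_index d s -> {RV P >-> R}).
Hypotheses (hxi : iid_std_normal xi) (eps0 : 0 < eps) (hk : (1 <= k <= s)%N).
Context (K M : nat) (node : 'I_K * 'I_M -> {set 'I_d}).
Hypotheses (node_inj : injective node) (node_in : forall p, node p \in Usets d k).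
Context (th : {set 'I_d} -> freq d -> R) (S : seq (obs_index d s)) (D : R).
Hypothesis uS : uniq S.
Hypothesis thS : forall j, supp (val j) \in Usets d k -> j \notin S ->
  th (supp (val j)) (val j) = 0.
Hypothesis thD : forall u, u \in Usets d k ->
  \sum_(j <- S | supp (val j) == u) (th u (val j) / eps) ^+ 4 / 4 <= D.
Context (eta0 : bvecs d).

Local Notation signs := {ffun 'I_(size S) -> bool}.
Local Notation config := {ffun 'I_K -> 'I_M * signs}.

Definition owner (u : {set 'I_d}) : option ('I_K * 'I_M) :=
  [pick p | u == node p].

Lemma owner_node p : owner (node p) = Some p.
Proof.
rewrite /owner; case: pickP => [p' /eqP/node_inj -> //|/(_ p)].
by rewrite eqxx.
Qed.

Lemma ownerP u p : owner u = Some p -> u = node p.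
Proof. by rewrite /owner; case: pickP => // p' /eqP -> [->]. Qed.

Definition sgf (t : signs) (l : freq d) : R :=
  if insub l is Some i then sgs R t i else 1.

Lemma sgf_val t (j : obs_index d s) : sgf t (val j) = sgs R t j.
Proof. by rewrite /sgf valK. Qed.

(** The k-subsets outside all blocks are inactive, which makes the number of active ones exactly
    [K]; the other cardinalities carry the fixed [eta0]. *)
Definition cfg_eta (f : config) : bvecs d := fun u =>
  if owner u is Some p then (f p.1).1 == p.2
  else if #|u| == k then false else eta0 u.

(** The signs of a block act on all its sets, so [theta] does not depend on the needle; sets other
    than the needle have [eta = 0] and the data do not show their signs. *)
Definition cfg_theta (f : config) : {set 'I_d} -> freq d -> R := fun u l =>
  if owner u is Some p then sgf (f p.1).2 l * th u l else th u l.

Lemma cfg_theta_sqr f u l : cfg_theta f u l ^+ 2 = th u l ^+ 2.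
Proof.
rewrite /cfg_theta; case: (owner u) => // p; rewrite exprMn /sgf.
by case: insub => [i|]; rewrite ?sgs_sqr ?expr1n mul1r.
Qed.

Lemma sum_cfg_eta f : (\sum_(u in Usets d k) cfg_eta f u)%N = K.
Proof.
transitivity (\sum_(u in Usets d k | cfg_eta f u) 1)%N.
  by rewrite [RHS]big_mkcondr; apply: eq_bigr => u _; case: (cfg_eta f u).
transitivity (\sum_(u in [set node (b, (f b).1) | b : 'I_K]%SET) 1)%N.
  apply: eq_bigl => u; apply/andP/imsetP.
    rewrite /cfg_eta; case ou: (owner u) => [[b v]|]; last first.
      by rewrite inE => -[->].
    by rewrite (ownerP ou) /= => -[_ /eqP <-]; exists b.
  move=> [b _ ->]; split; first exact: node_in.
  by rewrite /cfg_eta owner_node eqxx.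
rewrite big_imset/=; last by move=> b b' _ _ /node_inj[].
by rewrite sum1_card card_ord.
Qed.

Section fixed_selector.
Variable etat : data R d s -> bvecs d.
Hypothesis hetat : selector etat.

Definition obs (f : config) (w : Omega) : data R d s :=
  observation eps (cfg_eta f) (cfg_theta f) (fun i => xi i w).

(** The whole block has to be right, not only its entry at [v]: this makes the events disjoint in
    [v], and their failure a Hamming error inside the block. *)
Definition found (b : 'I_K) (v : 'I_M) : set (data R d s) :=
  [set x | forall v', etat x (node (b, v')) = (v' == v)].

Lemma card_node p : (1 <= #|node p| <= s)%N.
Proof. by have := node_in p; rewrite inE => /eqP ->. Qed.

Lemma measurable_found b v : measurable (found b v : set (dataT (obs_index d s) R)).
Proof.
have -> : found b v = \bigcap_(v' in [set: 'I_M])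
    [set x | etat x (node (b, v')) = (v' == v)].
  by apply/seteqP; split=> [x H v' _|x H v']; exact: H.
apply: fin_bigcap_measurable => // v' _.
have mE : measurable ([set x | etat x (node (b, v'))] : set (dataT (obs_index d s) R)).
  by apply: hetat; exact: card_node.
case: (v' == v) => //.
rewrite (_ : [set x | _ ] = ~` [set x | etat x (node (b, v'))]).
  exact: measurableC.
by apply/seteqP; split=> x /=; [move=> ->|move/negP/negbTE].
Qed.

Lemma measurable_obs f :
  measurable_fun setT (obs f : Omega -> dataT (obs_index d s) R).
Proof.
apply: measurable_to_data => i; apply: measurable_funD => //.
exact: measurable_funM.
Qed.

Lemma measurable_preimage_obs f (A : set (dataT (obs_index d s) R)) :
  measurable A -> measurable (obs f @^-1` A).
Proof.
by move=> mA; rewrite -[X in measurable X]setTI; exact: measurable_obs.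
Qed.

Definition pfound (b : 'I_K) (f : config) : R :=
  fine (P (obs f @^-1` found b (f b).1)).

Lemma pfoundE b f : P (obs f @^-1` found b (f b).1) = (pfound b f)%:E.
Proof.
rewrite /pfound fineK// fin_num_measure//.
by apply: measurable_preimage_obs; exact: measurable_found.
Qed.

Lemma sum_pfound_le (T : R) b f : 1 < T ->
  \sum_(x : 'I_M * signs) pfound b (upd f b x) <=
  2 ^+ size S * (T + M%:R * ((D + 1) / ln T)).
Proof.
move=> T1; pose base (i : obs_index d s) : R :=
  if owner (supp (val i)) is Some p then
    if p.1 == b then 0
    else (cfg_eta f (supp (val i)))%:R * cfg_theta f (supp (val i)) (val i)
  else (cfg_eta f (supp (val i)))%:R * cfg_theta f (supp (val i)) (val i).
pose h (v : 'I_M) (i : obs_index d s) : R :=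
  if owner (supp (val i)) == Some (b, v) then th (supp (val i)) (val i) / eps else 0.
pose G (x : dataT (obs_index d s) R) : dataT (obs_index d s) R :=
  fun i => base i + eps * x i.
have mG : measurable_fun setT G.
  apply: measurable_to_data => i; apply: measurable_funD => //.
  by apply: measurable_funM => //; exact: measurable_coord.
have obsE v t w : obs (upd f b (v, t)) w = G (shift S (signed t (h v)) (noise xi w)).
  apply/funext => i; rewrite /obs /observation /G /shift /noise /signed /base /h.
  rewrite /cfg_eta /cfg_theta.
  case ou: (owner (supp (val i))) => [[b' v']|]; last first.
    by rewrite /= mulr0 if_same addr0.
  rewrite ffunE /=; case: (eqVneq b' b) => [b'b|b'b]; last first.
    rewrite (_ : (Some (b', v') == Some (b, v)) = false); last first.
      by apply/negP => /eqP[/eqP]; rewrite (negbTE b'b).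
    by case: ifP => _; rewrite /=; ring.
  rewrite add0r /= b'b; have [->|vv'] := eqVneq v' v; last first.
    rewrite (_ : (Some (b, v') == Some (b, v)) = false); last first.
      by apply/negP => /eqP[/eqP]; rewrite (negbTE vv').
    by case: ifP => _; rewrite /=; ring.
  rewrite !eqxx mul1r sgf_val.
  case: ifPn => iS; first by field; rewrite gt_eqF.
  rewrite thS//; first by rewrite mulr0 addr0 add0r.
  by rewrite (ownerP ou).
pose B (v : 'I_M) : set (dataT (obs_index d s) R) := G @^-1` found b v.
have mB v : measurable (B v).
  by rewrite -[X in measurable X]setTI; apply: mG => //; exact: measurable_found.
have dB v v' x : B v x -> B v' x -> v = v'.
  by move=> /(_ v) + /(_ v); rewrite eqxx => -> /esym/eqP.
have hD v : \sum_(j <- S) h v j ^+ 4 / 4 <= D.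
  apply: le_trans (thD (node_in (b, v))).
  rewrite [leRHS]big_mkcond/= ler_sum// => j _; rewrite /h.
  case: (eqVneq (owner (supp (val j))) (Some (b, v))) => [/ownerP ->|_].
    by rewrite eqxx.
  rewrite expr0n mul0r; case: ifP => // _.
  by rewrite divr_ge0// exprn_even_ge0.
have := needle_bound hxi uS T1 mB dB hD.
rewrite card_ord -lee_fin; apply: le_trans.
have -> : \sum_x pfound b (upd f b x) = \sum_v \sum_t pfound b (upd f b (v, t)).
  by rewrite pair_big; apply: eq_bigr => -[v t] _.
rewrite -sumEFin; apply: lee_sum => v _; rewrite -sumEFin; apply: lee_sum => t _.
rewrite -pfoundE ffunE eqxx /= le_eqVlt; apply/orP; left; apply/eqP.
by congr (P _); apply/seteqP; split=> w /=; rewrite obsE.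
Qed.

Lemma hamming_found (f : config) x :
  K%:R - \sum_(b < K) (\1_(found b (f b).1) x : R) <=
  hamming R k (etat x) (cfg_eta f).
Proof.
pose F u : R := `|(etat x u)%:R - (cfg_eta f u)%:R|.
have F0 u : 0 <= F u by exact: normr_ge0.
have -> : hamming R k (etat x) (cfg_eta f) =
    \sum_(u in [set node p | p : 'I_K * 'I_M]%SET) F u +
    \sum_(u in Usets d k :\: [set node p | p : 'I_K * 'I_M]%SET) F u.
  rewrite /hamming (big_setID [set node p | p : 'I_K * 'I_M]%SET)/=; congr (_ + _).
  apply: eq_bigl => u; rewrite inE andbC; case: imsetP => //= -[p _ ->].
  by rewrite node_in.
apply: (@le_trans _ _ (\sum_(u in [set node p | p : 'I_K * 'I_M]%SET) F u)); last first.
  by rewrite lerDl sumr_ge0.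
rewrite big_imset/=; last by move=> p p' _ _; exact: node_inj.
have -> : \sum_p F (node p) = \sum_b \sum_v F (node (b, v)).
  by rewrite pair_big; apply: eq_bigr => -[b v] _.
have -> : K%:R = \sum_(b < K) 1 :> R by rewrite sumr_const card_ord.
rewrite -sumrB; apply: ler_sum => b _; rewrite indicE.
case: (boolP (x \in _)) => [_|/negP nx]; first by rewrite subrr sumr_ge0.
have [v xv] : exists v, etat x (node (b, v)) != (v == (f b).1).
  apply: contrapT => /forallNP H; apply: nx; apply/mem_set => v.
  by apply/eqP/negPn/negP; exact: H.
rewrite subr0 (bigD1 v)//= ler_wpDr ?sumr_ge0//.
rewrite /F /cfg_eta owner_node /= [_ == v]eq_sym.
by case: (etat _ _) xv; case: (v == _) => // _; rewrite ?subr0 ?sub0r ?normrN normr1.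
Qed.

Lemma measurable_loss f :
  measurable_fun setT (fun w => loss beta s (etat (obs f w)) (cfg_eta f)).
Proof.
rewrite /loss; under eq_fun do rewrite big_seq big_mkcond.
apply: measurable_sum => i.
have [|//] := boolP (i \in _); rewrite mem_index_iota ltnS => his.
apply: measurable_funM => //.
rewrite /hamming; under eq_fun do rewrite big_mkcond.
apply: measurable_sum => u; have [|//] := boolP (u \in _); rewrite inE => /eqP ui.
apply: measurableT_comp => //; apply: measurable_funB => //.
pose E : set (dataT (obs_index d s) R) := [set x | etat x u].
rewrite (_ : (fun x => _) = \1_(obs f @^-1` E)); last first.
  apply/funext => w; rewrite indicE.
  have -> // : (w \in obs f @^-1` E) = etat (obs f w) u.
  by apply/idP/idP => [/set_mem//|H]; exact/mem_set.
apply: measurable_indic; apply: measurable_preimage_obs.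
by apply: hetat; rewrite ui.
Qed.

Lemma risk_ge f : (('C(d, k)%:R `^ (beta - 1) *
    (K%:R - \sum_b pfound b f))%:E <=
  risk beta eps xi etat (cfg_eta f) (cfg_theta f))%E.
Proof.
set c := 'C(d, k)%:R `^ (beta - 1).
have c0 : 0 <= c by exact: powR_ge0.
have loss0 w : 0 <= loss beta s (etat (obs f w)) (cfg_eta f).
  by apply: sumr_ge0 => i _; rewrite mulr_ge0 ?powR_ge0// sumr_ge0.
have m1 b : measurable_fun setT (fun w => \1_(found b (f b).1) (obs f w) : R).
  apply: measurableT_comp (measurable_obs f).
  by apply: measurable_indic; exact: measurable_found.
(* The found blocks are added to the loss instead of subtracted from [K], so that only nonnegative
   functions are integrated. *)
have loss_ge w : c * K%:R <= loss beta s (etat (obs f w)) (cfg_eta f) +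
    \sum_b c * \1_(found b (f b).1) (obs f w).
  rewrite -mulr_sumr -lerBlDr -mulrBr.
  apply: le_trans (ler_wpM2l c0 (hamming_found f (obs f w))) _.
  rewrite /loss (bigD1_seq k)/= ?iota_uniq ?mem_index_iota//.
  rewrite lerDl sumr_ge0// => i _.
  by rewrite mulr_ge0 ?powR_ge0// sumr_ge0.
have s0 w : 0 <= \sum_b c * \1_(found b (f b).1) (obs f w).
  by apply: sumr_ge0 => b _; rewrite mulr_ge0.
have ms : measurable_fun setT (fun w => \sum_b c * \1_(found b (f b).1) (obs f w)).
  by apply: measurable_sum => b; exact: measurable_funM.
have : (\int[P]_w (c * K%:R)%:E <=
    \int[P]_w ((loss beta s (etat (obs f w)) (cfg_eta f))%:E +
      (\sum_b c * \1_(found b (f b).1) (obs f w))%:E))%E.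
  apply: ge0_le_integral => //.
  - by move=> w _; rewrite lee_fin mulr_ge0.
  - apply: emeasurable_funD; apply/measurable_EFinP => //.
    exact: measurable_loss.
  - by move=> w _; rewrite -EFinD lee_fin.
rewrite integral_cst//= probability_setT mule1.
rewrite ge0_integralD//; last 4 first.
- by move=> w _; rewrite lee_fin.
- by apply/measurable_EFinP; exact: measurable_loss.
- by move=> w _; rewrite lee_fin.
- exact/measurable_EFinP.
have -> : (\int[P]_w (\sum_b c * \1_(found b (f b).1) (obs f w))%:E =
    (c * \sum_b pfound b f)%:E)%E.
  under eq_integral do rewrite -sumEFin.
  rewrite ge0_integral_sum//; last 2 first.
  - by move=> b; apply/measurable_EFinP; exact: measurable_funM.
  - by move=> b w _; rewrite lee_fin mulr_ge0.
  rewrite mulr_sumr -sumEFin; apply: eq_bigr => b _.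
  under eq_integral do rewrite EFinM.
  rewrite ge0_integralZl_EFin//; last by exact/measurable_EFinP.
  rewrite EFinM -pfoundE; congr (_ * _)%E.
  rewrite (_ : (fun x => _) = fun w => (\1_(obs f @^-1` found b (f b).1) w)%:E)//.
  rewrite integral_indic ?setIT//.
  by apply: measurable_preimage_obs; exact: measurable_found.
have -> : risk beta eps xi etat (cfg_eta f) (cfg_theta f) =
    (\int[P]_w (loss beta s (etat (obs f w)) (cfg_eta f))%:E)%E.
  by rewrite /risk unlock.
by rewrite mulrBr EFinB leeBlDr.
Qed.

Lemma exists_risk_ge (T : R) : 1 < T -> (0 < M)%N ->
  exists f, (('C(d, k)%:R `^ (beta - 1) *
    (K%:R * (1 - (T / M%:R + (D + 1) / ln T))))%:E <=
  risk beta eps xi etat (cfg_eta f) (cfg_theta f))%E.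
Proof.
move=> T1 M0.
have Mn : M%:R != 0 :> R by rewrite pnatr_eq0 -lt0n.
have [||f fC] := @exists_sum_le R _ _ pfound (T / M%:R + (D + 1) / ln T).
- by split; [exact: Ordinal M0|exact: [ffun=> true]].
- move=> b f; apply: le_trans (sum_pfound_le b f T1) _.
  rewrite card_prod card_ord card_ffun card_bool card_ord natrM natrX.
  rewrite le_eqVlt; apply/orP; left; apply/eqP; field.
  by rewrite Mn gt_eqF// ln_gt0.
exists f; apply: le_trans (risk_ge f); rewrite lee_fin ler_wpM2l ?powR_ge0//.
by rewrite mulrBr mulr1 lerB//; move: fC; rewrite card_ord.
Qed.

End fixed_selector.
End risk_lower_bound.

(** * Admissible configurations and the minimax bound at a fixed noise level *)

Lemma Theta_ring_sqr (R : realType) (sigma r : R) (d : nat) (u : {set 'I_d})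
    (t1 t2 : freq d -> R) : (forall l, t1 l ^+ 2 = t2 l ^+ 2) ->
  Theta_ring sigma r u t1 -> Theta_ring sigma r u t2.
Proof.
move=> t12 [h1 h2]; split.
  by under eq_esum do rewrite -t12.
by under eq_esum do rewrite -t12.
Qed.

Section minimax_lower_bound.
Context (R : realType) (beta sigma e D : R) (r : nat -> R) (d s : nat).
Hypotheses (e0 : 0 < e) (beta01 : 0 < beta < 1) (sd : (s <= d)%N).
Hypothesis hr : forall k, (1 <= k <= s)%N ->
  0 < r k < (2 * pi) `^ (- sigma) * k%:R `^ (- (sigma / 2)).

Definition ones (k : nat) : nat := Num.truncn ('C(d, k)%:R `^ (1 - beta) : R).

Lemma card_Usets k : #|Usets d k| = 'C(d, k).
Proof. by rewrite /Usets -[X in 'C(X, _)](card_ord d) card_draws. Qed.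

Lemma ones_le k : (k <= d)%N -> (ones k <= 'C(d, k))%N.
Proof.
move=> kd; have N1 : 1 <= 'C(d, k)%:R :> R by rewrite ler1n bin_gt0.
rewrite -(ler_nat R); apply: (@le_trans _ _ ('C(d, k)%:R `^ (1 - beta))).
  by have /andP[] := truncn_itv (powR_ge0 ('C(d, k)%:R : R) (1 - beta)).
rewrite -[leRHS]powRr1; last exact: le_trans N1.
by rewrite ler_powR//; case/andP: beta01 => *; lra.
Qed.

(** An arbitrary member of the sparsity class, used at the cardinalities other than [k]. *)
Definition eta_ones : bvecs d := fun u => u \in take (ones #|u|) (enum (Usets d #|u|)).

Lemma sum_eta_ones k : (k <= d)%N -> (\sum_(u in Usets d k) eta_ones u)%N = ones k.
Proof.
move=> kd; pose T := take (ones k) (enum (Usets d k)).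
transitivity (\sum_(u in T) 1)%N; last first.
  rewrite sum1_card; have /card_uniqP -> : uniq T by rewrite take_uniq// enum_uniq.
  by rewrite size_takel// -cardE card_Usets ones_le.
have TU u : u \in T -> u \in Usets d k by move=> /mem_take; rewrite mem_enum.
rewrite big_mkcond [RHS]big_mkcond/=; apply: eq_bigr => u _.
case: ifPn => [|uk]; last by rewrite ifN//; exact: contra (TU u) uk.
by rewrite inE /eta_ones => /eqP ->; rewrite -/T; case: (u \in T).
Qed.

Section sparse_family.
Variables (k : nat) (hk : (1 <= k <= s)%N).
Hypothesis detectD : forall u, u \in Usets d k ->
  detect sigma e u (r k) ^+ 2 < 2 * D.

Lemma exists_theta : exists (th : {set 'I_d} -> freq d -> R)
    (S : {set 'I_d} -> seq (freq d)),
  forall u : {set 'I_d}, (1 <= #|u| <= s)%N -> [/\ uniq (S u), [set` S u] `<=` Zring u,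
    Theta_ring sigma (r #|u|) u (th u) & (forall l, l \notin S u -> th u l = 0) /\
    (u \in Usets d k -> \sum_(l <- S u) th u l ^+ 4 <= 2 * e ^+ 4 * (2 * D))].
Proof.
suff H (u : {set 'I_d}) : exists p : (freq d -> R) * seq (freq d), (1 <= #|u| <= s)%N ->
    [/\ uniq p.2, [set` p.2] `<=` Zring u,
    Theta_ring sigma (r #|u|) u p.1 & (forall l, l \notin p.2 -> p.1 l = 0) /\
    (u \in Usets d k -> \sum_(l <- p.2) p.1 l ^+ 4 <= 2 * e ^+ 4 * (2 * D))].
  have [F HF] := choice H.
  by exists (fun u => (F u).1), (fun u => (F u).2) => u; exact: HF.
have [hu|] := boolP (1 <= #|u| <= s)%N; last by exists (fun=> 0, [::]).
have u0 : (0 < #|u|)%N by case/andP: hu.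
have [uk|uk] := boolP (u \in Usets d k).
  have uE : #|u| = k by move: uk; rewrite inE => /eqP.
  have [||th [S [uS SA thr [thS th4]]]] :=
      @finite_support_theta R sigma e d u e0 u0 (r #|u|) (2 * D).
  - exact: hr.
  - by rewrite uE detectD.
  by exists (th, S).
(* At other cardinalities any point of the ellipsoid will do, so the level only has to exceed the
   squared detection function. *)
have [||th [S [uS SA thr [thS th4]]]] :=
    @finite_support_theta R sigma e d u e0 u0 (r #|u|)
      (detect sigma e u (r #|u|) ^+ 2 + 1).
- exact: hr.
- by rewrite ltrDl.
by exists (th, S).
Qed.

(** The supports over all k-subsets are merged into one list of observed indices. The bound [2 * D]
    turns into [D] because [(theta / e)^4 / 4] is half of the summand [theta^4 / (2 e^4)] of the
    squared detection function. *)
Lemma exists_observed_theta : exists (th : {set 'I_d} -> freq d -> R)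
    (S : seq (obs_index d s)), [/\ uniq S,
    forall u : {set 'I_d}, (1 <= #|u| <= s)%N -> Theta_ring sigma (r #|u|) u (th u),
    forall j, supp (val j) \in Usets d k -> j \notin S ->
      th (supp (val j)) (val j) = 0 &
    forall u, u \in Usets d k ->
      \sum_(j <- S | supp (val j) == u) (th u (val j) / e) ^+ 4 / 4 <= D].
Proof.
have [th [S0 H]] := exists_theta.
have card_k u : u \in Usets d k -> (1 <= #|u| <= s)%N.
  by rewrite inE => /eqP ->.
pose X := undup (flatten [seq S0 u | u <- enum (Usets d k)]).
pose S : seq (obs_index d s) := pmap insub X.
have uX : uniq X by exact: undup_uniq.
have SX (l : freq d) u : u \in Usets d k -> l \in S0 u -> l \in X.
  move=> uk lu; rewrite mem_undup; apply/flattenP; exists (S0 u) => //.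
  by apply: map_f; rewrite mem_enum.
exists th, S; split.
- exact: pmap_sub_uniq.
- by move=> u /H[].
- move=> j jk jS; have [_ _ _ [thS _]] := H _ (card_k _ jk).
  apply: thS; apply: contra jS => jS; rewrite mem_pmap_sub.
  exact: SX jS.
- move=> u uk; have [uSu _ _ [thS /(_ uk) thD]] := H _ (card_k _ uk).
  pose F (l : freq d) := (th u l / e) ^+ 4 / 4.
  have F0 l : 0 <= F l by rewrite divr_ge0// exprn_even_ge0.
  have FS l : l \notin S0 u -> F l = 0.
    by move=> /thS; rewrite /F => ->; rewrite mul0r expr0n mul0r.
  pose Y := [seq l <- map val S | (supp l == u) && (l \in S0 u)].
  have uY : uniq Y.
    rewrite filter_uniq// map_inj_uniq ?pmap_sub_uniq//; exact: val_inj.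
  have -> : \sum_(j <- S | supp (val j) == u) (th u (val j) / e) ^+ 4 / 4 =
      \sum_(l <- Y) F l.
    rewrite big_filter big_map big_mkcond [RHS]big_mkcond/=.
    apply: eq_bigr => j _; case: ifP => //= _; case: ifPn => // jS.
    exact: FS.
  apply: (@le_trans _ _ (\sum_(l <- S0 u) F l)).
    rewrite -lee_fin -(@esum_finite_support _ _ [set` S0 u] _ F0 (S0 u))//.
    apply: (@sum_le_esum _ _ _ F Y) => // l /=.
    by rewrite mem_filter => /andP[/andP[]].
  have -> : \sum_(l <- S0 u) F l = (\sum_(l <- S0 u) th u l ^+ 4) / (4 * e ^+ 4).
    rewrite mulr_suml; apply: eq_bigr => l _; rewrite /F; field.
    by rewrite gt_eqF.
  rewrite ler_pdivrMr ?mulr_gt0 ?exprn_gt0//; apply: le_trans thD _.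
  by lra.
Qed.

End sparse_family.

Lemma minimax_risk_ge (disp : measure_display) (Omega : measurableType disp)
    (P : probability Omega R) (xi : obs_index d s -> {RV P >-> R})
    (delta : nat -> R) (k : nat) (T : R) :
  iid_std_normal xi ->
  (forall k (eta : bvecs d), (1 <= k <= s)%N ->
    (\sum_(u in Usets d k) eta u)%N = ones k -> Hclass beta (delta k) k eta) ->
  (1 <= k <= s)%N -> 1 < T ->
  (forall u, u \in Usets d k -> detect sigma e u (r k) ^+ 2 < 2 * D) ->
  (0 < 'C(d, k) %/ ones k)%N ->
  (('C(d, k)%:R `^ (beta - 1) * ((ones k)%:R *
    (1 - (T / ('C(d, k) %/ ones k)%:R + (D + 1) / ln T))))%:E <=
  minimax_risk beta sigma e delta r xi)%E.
Proof.
move=> hxi hH hk T1 hdet M0.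
have [th [S [uS thT thS thD]]] := exists_observed_theta hk hdet.
set K := ones k; set M := ('C(d, k) %/ K)%N in M0 *.
(* Consecutive runs of length [M] in an enumeration of the k-subsets; the remainder of the division
   by [K] belongs to no block. *)
pose node (p : 'I_K * 'I_M) : {set 'I_d} :=
  nth finset.set0 (enum (Usets d k)) (p.1 * M + p.2).
have node_lt (p : 'I_K * 'I_M) : (p.1 * M + p.2 < size (enum (Usets d k)))%N.
  rewrite -cardE card_Usets; apply: (@leq_trans (K * M)); last first.
    by rewrite mulnC; exact: leq_trunc_div.
  apply: (@leq_trans (p.1 * M + M)); first by rewrite ltn_add2l.
  by rewrite addnC -mulSn leq_mul2r ltn_ord orbT.
have node_inj : injective node.
  move=> [b v] [b' v'] /eqP; rewrite nth_uniq ?enum_uniq// => /eqP /= E.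
  have vv : v = v' :> nat.
    by have := congr1 (modn^~ M) E; rewrite !modnMDl !modn_small.
  have bb : b = b' :> nat.
    have := congr1 (divn^~ M) E; rewrite !divnMDl// !divn_small// !addn0.
    by [].
  by congr pair; exact: val_inj.
have node_in p : node p \in Usets d k by rewrite -mem_enum mem_nth.
apply: le_ereal_inf_tmp => _ [etat hetat <-].
have [f hf] := exists_risk_ge beta hxi e0 hk node_inj node_in uS thS thD eta_ones
  hetat T1 M0.
apply: (le_trans hf).
apply: (@le_trans _ _ (ereal_sup [set risk beta e xi etat
    (cfg_eta k node eta_ones f) theta | theta in @Theta R sigma r d s])).
  apply: ereal_sup_ubound; exists (cfg_theta node th f) => //.
  move=> k' u hk' uk'; have uE : #|u| = k' by move: uk'; rewrite inE => /eqP.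
  apply: (@Theta_ring_sqr _ _ _ _ _ (th u)).
    by move=> l; rewrite cfg_theta_sqr.
  by rewrite -uE; apply: thT; rewrite uE.
apply: ereal_sup_ubound; exists (cfg_eta k node eta_ones f) => //.
move=> k' hk'; apply: hH => //; have [->|kk'] := eqVneq k' k.
  exact: sum_cfg_eta.
have k'd : (k' <= d)%N by case/andP: hk' => _ /leq_trans; apply.
rewrite -(sum_eta_ones k'd); apply: eq_bigr => u; rewrite inE => /eqP uk'.
rewrite /cfg_eta; case ou: (owner node u) => [p|]; last first.
  by rewrite uk' (negbTE kk').
have := node_in p; rewrite -(ownerP ou) inE uk' => /eqP kE.
by rewrite kE eqxx in kk'.
Qed.

End minimax_lower_bound.

(** * Growth of binomial coefficients and choice of the exponents *)

Lemma leq_bin (n k : nat) : (0 < k < n)%N -> (n <= 'C(n, k))%N.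
Proof.
elim: n k => [|n IH] [|k]//; rewrite !ltnS => kn.
have [->|kn'] := eqVneq k.+1 n; first by rewrite binSn.
rewrite binS -addn1; apply: leq_add; last by rewrite bin_gt0 ltnW.
by apply: IH; rewrite /= ltn_neqAle kn'.
Qed.

Section sparsity_asymptotics.
Context (R : realType) (b1 beta : R).
Hypotheses (b10 : 0 < b1) (b1beta : b1 < beta) (beta1 : beta < 1).

Definition mid_exp : R := (b1 + beta) / 2.
Local Notation b2 := mid_exp.
Definition gap : R := 1 - b1 / b2.

Lemma gap_gt0 : 0 < gap.
Proof.
move: b10 b1beta => b1_gt0 b1_lt.
have b20 : 0 < b2 by rewrite /mid_exp; lra.
by rewrite subr_gt0 ltr_pdivrMr// mul1r /mid_exp; lra.
Qed.

(** The three terms ensure in turn [2 <= N^beta], [T / M <= gap / 4] and [1 / ln T <= gap / 4]; all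
    are positive, so their sum dominates each of them. *)
Definition ln_threshold : R :=
  beta^-1 + 8 / (gap * (beta - b2)) + 4 / (gap * b2).

Lemma sparse_risk_ge (N : nat) (K := Num.truncn (N%:R `^ (1 - beta) : R))
    (T : R := N%:R `^ b2) (D : R := b1 * ln N%:R) : (0 < N)%N ->
  ln_threshold <= ln N%:R ->
  [/\ 1 < T, (0 < N %/ K)%N &
    gap / 4 <= N%:R `^ (beta - 1) *
      (K%:R * (1 - (T / (N %/ K)%:R + (D + 1) / ln T)))].
Proof.
move: b10 b1beta beta1 => b1_gt0 b1_lt beta_lt1.
move=> N0; set x : R := N%:R; set l := ln x => hl.
have x0 : 0 < x by rewrite ltr0n.
have g0 := gap_gt0.
have b20 : 0 < b2 by rewrite /mid_exp; lra.
have b2b : 0 < beta - b2 by rewrite /mid_exp; lra.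
have be0 : 0 < beta by lra.
have A1 : 0 < beta^-1 by rewrite invr_gt0.
have A2 : 0 < 8 / (gap * (beta - b2)) by rewrite divr_gt0 ?mulr_gt0.
have A3 : 0 < 4 / (gap * b2) by apply: divr_gt0 => //; exact: mulr_gt0.
move: hl; rewrite /ln_threshold => hl.
have l0 : 0 < l by lra.
have powE a : x `^ a = expR (a * l) by rewrite /powR gt_eqF.
have T1 : 1 < T by rewrite /T powE expR_gt1 mulr_gt0.
have lT : ln T = b2 * l by rewrite /T powE expRK.
set y : R := x `^ (1 - beta).
have y1 : 1 <= y by rewrite /y powE -[leLHS]expR0 ler_expR mulr_ge0//; lra.
have [Ky yK] : K%:R <= y /\ y < K.+1%:R.
  by have /andP[] := truncn_itv (le_trans ler01 y1 : 0 <= y).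
have K0 : (0 < K)%N.
  by rewrite -ltnS -(ltr_nat R); exact: le_lt_trans yK.
have Kge : y / 2 <= K%:R.
  have : 1 <= K%:R :> R by rewrite ler1n.
  by move: yK; rewrite -natr1; lra.
have xb : x = y * x `^ beta.
  by rewrite /y !powE -expRD -mulrDl subrK mul1r lnK.
have be2 : 2 <= x `^ beta.
  rewrite powE; apply: le_trans (expR_ge1Dx _).
  have : beta * beta^-1 <= beta * l by rewrite ler_pM2l//; lra.
  by rewrite divff ?gt_eqF//; lra.
set M := (N %/ K)%N.
(* From [x < (M + 1) K <= (M + 1) y] follows [x^beta < M + 1], and [2 <= x^beta] absorbs the 1. *)
have Mge : x `^ beta / 2 <= M%:R.
  have : (N < M.+1 * K)%N by rewrite ltn_ceil.
  rewrite -(ltr_nat R) natrM -/x -natr1 => H.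
  have M1 : 0 <= M%:R + 1 :> R by rewrite addr_ge0.
  have := lt_le_trans H (ler_wpM2l M1 Ky).
  rewrite {1}xb mulrC ltr_pM2r; last exact: lt_le_trans y1.
  by lra.
have M0R : 0 < M%:R :> R by apply: lt_le_trans Mge; lra.
have M0 : (0 < M)%N by rewrite -(ltr0n R).
split => //.
have rho1 : T / M%:R <= gap / 4.
  apply: (@le_trans _ _ (T / (x `^ beta / 2))).
    by rewrite ler_pM2l ?(lt_trans ltr01)// lef_pV2// posrE; lra.
  have -> : T / (x `^ beta / 2) = 2 * expR (- ((beta - b2) * l)).
    rewrite /T !powE invf_div mulrCA -expRN -expRD; congr (_ * expR _).
    ring.
  have : expR (- ((beta - b2) * l)) <= ((beta - b2) * l)^-1.
    rewrite expRN lef_pV2 ?posrE ?expR_gt0 ?mulr_gt0//.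
    by apply: le_trans (expR_ge1Dx _); rewrite lerDr.
  have : ((beta - b2) * l)^-1 <= gap / 8.
    rewrite -[leRHS]invrK invf_div lef_pV2 ?posrE ?divr_gt0 ?mulr_gt0//.
    rewrite -ler_pdivrMl//.
    have -> : (beta - b2)^-1 * (8 / gap) = 8 / (gap * (beta - b2)).
      by field; rewrite !gt_eqF.
    lra.
  by lra.
have rho2 : (D + 1) / ln T <= b1 / b2 + gap / 4.
  rewrite lT.
  have -> : (D + 1) / (b2 * l) = b1 / b2 + (b2 * l)^-1.
    by rewrite /D -/l; field; rewrite !gt_eqF.
  have bl0 : 0 < b2 * l by exact: mulr_gt0.
  have g40 : 0 < 4 / gap by exact: divr_gt0.
  rewrite lerD2l -[leRHS]invrK invf_div lef_pV2 ?posrE// -ler_pdivrMl//.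
  have -> : b2^-1 * (4 / gap) = 4 / (gap * b2) by field; rewrite !gt_eqF.
  lra.
have rho : gap / 2 <= 1 - (T / M%:R + (D + 1) / ln T).
  by move: rho1 rho2; rewrite /gap; lra.
have -> : x `^ (beta - 1) = y^-1.
  by rewrite /y !powE -expRN; congr expR; ring.
apply: (@le_trans _ _ (y^-1 * (y / 2 * (gap / 2)))).
  rewrite le_eqVlt; apply/orP; left; apply/eqP; field.
  by rewrite gt_eqF// (lt_le_trans ltr01).
rewrite ler_wpM2l ?invr_ge0 ?(le_trans ler01)//.
apply: ler_pM => //; [|by rewrite divr_ge0// ltW].
by rewrite divr_ge0// (le_trans ler01).
Qed.

End sparsity_asymptotics.

(** * The passage to the limit in the noise level *)

Lemma bigmin_ereal_le (R : realType) (q : R) (m n : nat) (F : nat -> \bar R) :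
  (\big[Order.min/+oo]_(m <= k < n) F k <= q%:E)%E ->
  exists k, (m <= k < n)%N /\ (F k <= q%:E)%E.
Proof.
move=> H; apply: contrapT => /forallNP H'.
suff : (q%:E < \big[Order.min/+oo]_(m <= k < n) F k)%E.
  by move=> /lt_le_trans => /(_ _ H); rewrite ltxx.
rewrite big_seq; apply: (big_ind (fun z => q%:E < z)%E).
- exact: ltry.
- by move=> a b ha hb; rewrite lt_min ha hb.
- move=> k; rewrite mem_index_iota => hk; rewrite ltNge.
  by apply/negP => hF; apply: (H' k).
Qed.

Theorem theorem5 (R : realType) (beta sigma : R) (s : nat) (d : R -> nat)
    (r : R -> nat -> R) (delta : R -> nat -> R)
    (disp : R -> measure_display)
    (Omega : forall e : R, measurableType (disp e))
    (P : forall e : R, probability (Omega e) R)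
    (xi : forall e : R, obs_index (d e) s -> {RV (P e) >-> R})
    (hbeta : 0 < beta < 1) (hsigma : 0 < sigma)
    (hs : forall e : R, 0 < e -> (1 <= s <= d e)%N)
    (hd : d e @[e --> 0^'+] --> \oo)
    (hed : e ^+ 2 * ln (d e)%:R `^ (1 + 2 * sigma) @[e --> 0^'+] --> (0 : R))
    (hxi : forall e : R, 0 < e -> iid_std_normal (xi e))
    (hdelta : forall k, (1 <= k <= s)%N -> delta e k @[e --> 0^'+] --> (0 : R))
    (hdelta_large : forall (e : R) (k : nat) (eta : bvecs (d e)),
       0 < e -> (1 <= k <= s)%N ->
       (\sum_(u in Usets (d e) k) eta u)%N
         = Num.truncn ('C(d e, k)%:R `^ (1 - beta) : R) ->
       Hclass beta (delta e k) k eta)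
    (hr : forall (e : R) (k : nat), 0 < e -> (1 <= k <= s)%N ->
       0 < r e k < (2 * pi) `^ (- sigma) * k%:R `^ (- (sigma / 2)))
    (hdetect : forall u : (forall e : R, nat -> {set 'I_(d e)}),
       (forall (e : R) (k : nat), 0 < e -> (1 <= k <= s)%N ->
          u e k \in Usets (d e) k) ->
       (limf_esup (fun e : R =>
          \big[Order.min/+oo]_(1 <= k < s.+1)
            (detect sigma e (u e k) (r e k)
             / Num.sqrt (2 * ln ('C(d e, k)%:R : R)))%:E) 0^'+
        < (Num.sqrt beta)%:E)%E) :
  (0 < limf_einf (fun e : R =>
         minimax_risk beta sigma e (delta e) (r e) (xi e)) 0^'+)%E.
Proof.
have /andP[beta0 beta1] := hbeta.
have sb0 : 0 < Num.sqrt beta by rewrite sqrtr_gt0.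
(* The hypothesis holds for every choice of the sets. Applied to a set with the largest detection
   function, it controls all k-subsets at once, without an appeal to symmetry. *)
have worst (e : R) (k : nat) : exists u, 0 < e -> (1 <= k <= s)%N -> u \in Usets (d e) k /\
    forall u', u' \in Usets (d e) k ->
      detect sigma e u' (r e k) <= detect sigma e u (r e k).
  have [e0|] := boolP (0 < e); last by exists finset.set0.
  have [hk|] := boolP (1 <= k <= s)%N; last by exists finset.set0.
  have /card_gt0P[u0 u0k] : (0 < #|Usets (d e) k|)%N.
    rewrite card_Usets bin_gt0.
    by have /andP[_] := hs e e0; apply: leq_trans; case/andP: hk.
  have [u uk umax] := @Order.TotalTheory.arg_maxP _ _ _ u0 (mem (Usets (d e) k))
    (fun u => detect sigma e u (r e k)) u0k.
  by exists u => _ _; split.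
pose u (e : R) (k : nat) := sval (cid (worst e k)).
have uP (e : R) (k : nat) : 0 < e -> (1 <= k <= s)%N -> u e k \in Usets (d e) k /\
    forall u', u' \in Usets (d e) k ->
      detect sigma e u' (r e k) <= detect sigma e (u e k) (r e k).
  exact: svalP (cid (worst e k)).
have := hdetect u (fun e k e0 hk => proj1 (uP e k e0 hk)).
rewrite limf_esupE => /ereal_inf_lt[_ [V V0 <-]] supV.
have [q [q0 qb qV]] : exists q : R, [/\ 0 < q, q < Num.sqrt beta &
    (ereal_sup ((fun e : R => \big[Order.min/+oo]_(1 <= k < s.+1)
      (detect sigma e (u e k) (r e k)
        / Num.sqrt (2 * ln ('C(d e, k)%:R : R)))%:E) @` V) <= q%:E)%E].
  set S := ereal_sup _ in supV *.
  (* The maximum keeps [q] positive; it also covers [-oo], where [fine] returns 0. *)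
  exists (Num.max (Num.sqrt beta / 2) (fine S)); split.
  - by rewrite lt_max divr_gt0.
  - rewrite gt_max ltr_pdivrMr// ltr_pMr// ltr1n/=.
    by case: S supV => //= z; rewrite lte_fin.
  - by case: S supV => [z _||_]//=; rewrite ?leNye// lee_fin le_max lexx orbT.
have q2b : q ^+ 2 < beta by rewrite -[ltRHS]sqr_sqrtr ?ltW// ltr_pXn2r// nnegrE ltW.
(* Strictly above [q ^+ 2], as a finitely supported [theta] only approaches the infimum, and
   strictly below [beta], as [gap] has to be positive. *)
pose b1 := (q ^+ 2 + beta) / 2.
have q20 : 0 < q ^+ 2 by rewrite exprn_gt0.
have b10 : 0 < b1 by rewrite /b1; lra.
have b1b : b1 < beta by rewrite /b1; lra.
have qb1 : q ^+ 2 < b1 by rewrite /b1; lra.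
have g0 := gap_gt0 b10 b1b.
(* The first term gives [k <= s < d e], which excludes the binomial coefficient 1 at [k = d e]; the
   second puts [ln (d e)] above the threshold. *)
pose n0 := maxn s.+1 (Num.truncn (expR (ln_threshold b1 beta))).+1.
pose W := V `&` [set e | 0 < e /\ (n0 <= d e)%N].
have W0 : 0^'+ W.
  apply: filterI => //; apply: filterI; first exact: nbhs_right_gt.
  exact: hd (nbhs_infty_ge n0).
rewrite limf_einfE; apply: (@lt_le_trans _ _ (gap b1 beta / 4)%:E).
  by rewrite lte_fin divr_gt0.
apply: le_trans (ereal_sup_ubound _); last by exists W.
apply: le_ereal_inf_tmp => _ [e [Ve [e0 nd]] <-].
have /bigmin_ereal_le[k []] : (\big[Order.min/+oo]_(1 <= k < s.+1)
    (detect sigma e (u e k) (r e k)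
      / Num.sqrt (2 * ln ('C(d e, k)%:R : R)))%:E <= q%:E)%E.
  by apply: le_trans qV; apply: ereal_sup_ubound; exists e.
rewrite ltnS lee_fin => hk hkq.
have /andP[_ sd] := hs e e0.
have sd' : (s < d e)%N by apply: leq_trans nd; rewrite leq_maxl.
(* The minimising [k] may change with [e]; this bound makes one threshold on [d e] serve every
   [k]. *)
have Nd : (d e <= 'C(d e, k))%N.
  apply: leq_bin; case/andP: hk => -> ks /=; exact: leq_ltn_trans sd'.
have N0 : (0 < 'C(d e, k))%N by apply: leq_trans Nd; exact: leq_ltn_trans sd'.
have lnN : ln_threshold b1 beta <= ln 'C(d e, k)%:R.
  rewrite -[leLHS]expRK ler_ln ?posrE ?expR_gt0 ?ltr0n//.
  apply: (@le_trans _ _ (d e)%:R); last by rewrite ler_nat.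
  apply: (@le_trans _ _ n0%:R); last by rewrite ler_nat.
  apply: ltW; apply: lt_le_trans (truncnS_gt _) _.
  by rewrite ler_nat leq_maxr.
have [T1 M0 Rge] := sparse_risk_ge b10 b1b beta1 N0 lnN.
have ln0 : 0 < ln 'C(d e, k)%:R :> R.
  apply: lt_le_trans lnN; rewrite /ln_threshold.
  have h1 : 0 < beta^-1 by rewrite invr_gt0.
  have h2 : 0 < 8 / (gap b1 beta * (beta - mid_exp b1 beta)).
    by rewrite divr_gt0// mulr_gt0// /mid_exp; lra.
  have h3 : 0 < 4 / (gap b1 beta * (mid_exp b1 beta)).
    by rewrite divr_gt0// mulr_gt0// /mid_exp; lra.
  lra.
have det u' : u' \in Usets (d e) k ->
    detect sigma e u' (r e k) ^+ 2 < 2 * (b1 * ln 'C(d e, k)%:R).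
  move=> u'k; have {}u'k := (uP e k e0 hk).2 _ u'k.
  have s0 : 0 < Num.sqrt (2 * ln 'C(d e, k)%:R : R) by rewrite sqrtr_gt0 mulr_gt0.
  move: hkq; rewrite ler_pdivrMr// => hkq.
  have d0 : 0 <= detect sigma e u' (r e k) by exact: sqrtr_ge0.
  have D2 : detect sigma e u' (r e k) ^+ 2 <= q ^+ 2 * (2 * ln 'C(d e, k)%:R).
    rewrite -[X in _ * X]sqr_sqrtr ?mulr_ge0 ?(ltW ln0)// -exprMn.
    rewrite ler_pXn2r ?nnegrE ?mulr_ge0 ?(ltW q0) ?(ltW s0)//.
    exact: le_trans u'k hkq.
  apply: (le_lt_trans D2); rewrite mulrCA ltr_pM2l// ltr_pM2r//.
have := minimax_risk_ge e0 hbeta sd (fun k => @hr e k e0) (hxi e e0)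
  (fun k eta hk => @hdelta_large e k eta e0 hk) hk T1 det M0.
by apply: le_trans; rewrite lee_fin.
Qed.
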